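(* Let $n\ge1$, $Q=2n+2$, $m\in\mathbb{N}$ ($m\ge1$), $1<q<\infty$, $1<q_j<\infty$ and $\alpha_j\in\mathbb{R}$ for $j=1,\dots,m$, with $\frac1q=\frac1{q_1}+\cdots+\frac1{q_m}$ and $\alpha=\alpha_1+\cdots+\alpha_m$. Assume that $-\frac{\alpha_j}{q}-\frac{Q}{q_j}+Q>0$ for every $j=1,\dots,m$. Then the $m$-linear $n$-dimensional Hardy operator $\mathcal{H}_1^h$, acting on radial functions $f_j\in L^{q_j}(\mathbb{H}^n,|x|_h^{q_j\alpha_j/q})$, satisfies $$\left\|\mathcal{H}_1^h\right\|_{L^{q_1}(\mathbb{H}^n,|x|_h^{q_1\alpha_1/q})\times\cdots\times L^{q_m}(\mathbb{H}^n,|x|_h^{q_m\alpha_m/q})\to L^q(\mathbb{H}^n,|x|_h^{\alpha})}=\frac{q\,\omega_Q^m\,2^{1-m}}{mqQ-\alpha-Q}\cdot\frac{\prod_{j=1}^m\Gamma\left(\left(Q-\frac{\alpha_j}{q}-\frac{Q}{q_j}\right)/2\right)}{\Gamma\left(\left(mQ-\frac{\alpha}{q}-\frac{Q}{q}\right)/2\right)}.$$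
   Context: The Heisenberg group $\mathbb{H}^n$ is, as a manifold, $\mathbb{R}^{2n+1}$; its Haar measure is Lebesgue measure $dx$ on $\mathbb{R}^{2n+1}$, its dilations are $\delta_r(x_1,\dots,x_{2n},x_{2n+1})=(rx_1,\dots,rx_{2n},r^2x_{2n+1})$ for $r>0$, and its homogeneous dimension is $Q=2n+2$. The homogeneous norm is $|x|_h=\big[\big(\sum_{i=1}^{2n}x_i^2\big)^2+x_{2n+1}^2\big]^{1/4}$. Put $B(0,1)=\{x:|x|_h<1\}$, $\Omega_Q=|B(0,1)|$ (Lebesgue measure) and $\omega_Q=Q\,\Omega_Q$. For $(y_1,\dots,y_m)\in(\mathbb{H}^n)^m$ put $|(y_1,\dots,y_m)|_h=\big(\sum_{j=1}^m|y_j|_h^2\big)^{1/2}$. A function $f$ on $\mathbb{H}^n$ is radial if $f(x)$ depends only on $|x|_h$. $\Gamma$ is Euler's gamma function. The $m$-linear $n$-dimensional Hardy operator is $$\mathcal{H}_1^h(f_1,\dots,f_m)(x)=\frac{1}{|x|_h^{mQ}}\int_{|(y_1,\dots,y_m)|_h\le|x|_h}f_1(y_1)\cdots f_m(y_m)\,dy_1\cdots dy_m,\qquad x\in\mathbb{H}^n\setminus\{0\}.$$ For a positive measurable weight $w$ (defined almost everywhere), $\|f\|_{L^p(\mathbb{H}^n,w)}=\big(\int_{\mathbb{H}^n}|f(x)|^pw(x)\,dx\big)^{1/p}$. The operator norm is the supremum of $\|\mathcal{H}_1^h(f_1,\dots,f_m)\|_{L^q(\mathbb{H}^n,|x|_h^{\alpha})}\big/\prod_{j=1}^m\|f_j\|_{L^{q_j}(\mathbb{H}^n,|x|_h^{q_j\alpha_j/q})}$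 over all radial $f_j$ with $0<\|f_j\|_{L^{q_j}(\mathbb{H}^n,|x|_h^{q_j\alpha_j/q})}<\infty$. *)

(* Defs.v *)
From HB Require Import structures.
From mathcomp Require Import all_boot all_order all_algebra.
From mathcomp Require Import all_classical all_reals all_analysis.

Set Implicit Arguments.
Unset Strict Implicit.
Unset Printing Implicit Defensive.
Import Order.TTheory GRing.Theory Num.Theory.
Import numFieldNormedType.Exports.

Local Open Scope classical_set_scope.
Local Open Scope ring_scope.

Definition cons_pair (T : Type) (n : nat) (p : T * n.-tuple T) : n.+1.-tuple T :=
  [tuple of p.1 :: p.2].

Lemma measurable_cons_pair d (T : measurableType d) n :
  measurable_fun [set: T * n.-tuple T] (@cons_pair T n).
Proof. exact: measurable_cons. Qed.

Definition cons_measure d (T : measurableType d) (R : realType) (n : nat)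
    (mu : set T -> \bar R) (nu : set (n.-tuple T) -> \bar R) :
  set (n.+1.-tuple T) -> \bar R :=
  pushforward (mu \x nu)%E (@cons_pair T n).

Section cons_measure.
Local Open Scope ereal_scope.
Context d (T : measurableType d) (R : realType) (n : nat).
Variables (mu : {sigma_finite_measure set T -> \bar R})
          (nu : {sigma_finite_measure set (n.-tuple T) -> \bar R}).

Let cm0 : cons_measure mu nu set0 = 0.
Proof. by rewrite /cons_measure /pushforward preimage_set0 measure0. Qed.

Let cm_ge0 A : 0 <= cons_measure mu nu A.
Proof. by rewrite /cons_measure /pushforward; exact: measure_ge0. Qed.

Let cm_sigma_additive : semi_sigma_additive (cons_measure mu nu).
Proof.
have mf := @measurable_cons_pair d T n.
move=> F mF tF mUF; rewrite /cons_measure /pushforward preimage_bigcup.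
apply: measure_semi_sigma_additive.
- by move=> k; rewrite -[X in measurable X]setTI; exact: mf.
- apply/trivIsetP => /= i j _ _ ij; rewrite -preimage_setI.
  by move/trivIsetP : tF => /(_ _ _ _ _ ij) ->//; rewrite preimage_set0.
- by rewrite -preimage_bigcup -[X in measurable X]setTI; exact: mf.
Qed.

HB.instance Definition _ := isMeasure.Build _ _ _ (cons_measure mu nu)
  cm0 cm_ge0 cm_sigma_additive.

Let cm_sigma_finite : sigma_finite setT (cons_measure mu nu).
Proof.
have /sigma_finiteP[F [TF ndF Foo]] := sigma_finiteT mu.
have /sigma_finiteP[G [TG ndG Goo]] := sigma_finiteT nu.
pose g (t : n.+1.-tuple T) : T * n.-tuple T := (thead t, [tuple of behead t]).
have mg : measurable_fun [set: n.+1.-tuple T] g.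
  apply: measurable_fun_pair; last exact: measurable_behead.
  exact: measurable_tnth.
have cg p : g (cons_pair p) = p.
  case: p => a t; rewrite /g /cons_pair theadE; congr pair.
  by apply: val_inj.
exists (fun k => g @^-1` (F k `*` G k)).
  rewrite -preimage_bigcup -(preimage_setT g); congr (_ @^-1` _).
  rewrite -setXTT TF TG predeqE => -[x y]; split.
    move=> [/= [i _ Fix] [j _ Gjy]]; exists (maxn i j) => //; split.
    - by move: x Fix; exact/subsetPset/ndF/leq_maxl.
    - by move: y Gjy; exact/subsetPset/ndG/leq_maxr.
  by move=> [i _ []/= ? ?]; split; exists i.
move=> k; have [mFk Fkoo] := Foo k; have [mGk Gkoo] := Goo k; split.
  by rewrite -[X in measurable X]setTI; apply: mg => //; exact: measurableX.
suff -> : cons_measure mu nu (g @^-1` (F k `*` G k)) = mu (F k) * nu (G k).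
  by rewrite lte_mul_pinfty// ge0_fin_numE.
rewrite -product_measure1E//.
rewrite /cons_measure /pushforward; congr (_ _).
by apply/funext => p; rewrite /preimage /mkset cg.
Qed.

HB.instance Definition _ := @Measure_isSigmaFinite.Build _ _ _
  (cons_measure mu nu) cm_sigma_finite.

End cons_measure.

(* The n-fold product measure mu x ... x mu on n-tuples, with the product
   sigma-algebra. *)
Fixpoint power_measure d (T : measurableType d) (R : realType)
    (mu : {sigma_finite_measure set T -> \bar R}) (n : nat) :
    {sigma_finite_measure set (n.-tuple T) -> \bar R} :=
  match n with
  | 0 => \d_([tuple] : 0.-tuple T)
  | n'.+1 => cons_measure mu (power_measure mu n')
  end.

Lemma power_measure_box d (T : measurableType d) (R : realType)
    (mu : {sigma_finite_measure set T -> \bar R}) n (A : 'I_n -> set T) :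
  (forall i, measurable (A i)) ->
  power_measure mu n [set x | forall i, A i (tnth x i)] =
  (\prod_(i < n) mu (A i))%E.
Proof.
elim: n A => [|n IHn] A mA.
  rewrite big_ord0 /= /dirac indicE mem_set//.
  by case.
rewrite big_ord_recl -IHn// /= /cons_measure /pushforward.
rewrite -product_measure1E//; last first.
  rewrite (_ : mkset _ = \bigcap_(i in [set: 'I_n])
     ((fun x : n.-tuple T => tnth x i) @^-1` A (lift ord0 i))).
    apply: fin_bigcap_measurable => // i _.
    by rewrite -[X in measurable X]setTI; exact: measurable_tnth.
  by apply/seteqP; split => x /= h i; [move=> _|]; exact: h.
congr (_ _); apply/seteqP; split => -[a t] /= h.
- split; first by have := h ord0; rewrite /cons_pair /= tnth0.
  by move=> i; have := h (lift ord0 i); rewrite tnthS.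
- case: h => ha ht i; case: (unliftP ord0 i) => [j|] ->.
    by rewrite tnthS; exact: ht.
  by rewrite tnth0.
Qed.

(* The underlying manifold R^(2n+1) of the Heisenberg group, with its Borel
   sigma-algebra. *)
Notation heisenberg R n := ((2 * n).+1.-tuple (measurableTypeR R)).

Definition heisenberg_measure (R : realType) (n : nat) :
    {sigma_finite_measure set (heisenberg R n) -> \bar R} :=
  power_measure (@lebesgue_measure R) (2 * n).+1.

Section heisenberg.
Context (R : realType) (n : nat).
Local Notation H := (heisenberg R n).
Local Notation mu := (heisenberg_measure R n).

Definition hdim : nat := 2 * n + 2.
Local Notation Q := hdim.

Definition hcoord (x : H) (i : 'I_(2 * n).+1) : R := tnth x i.

Definition hnorm (x : H) : R :=
  ((\sum_(i < 2 * n) hcoord x (widen_ord (leqnSn (2 * n)) i) ^+ 2) ^+ 2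
    + hcoord x ord_max ^+ 2) `^ 4^-1.

Definition hball : set H := [set x | hnorm x < 1].

Definition Omega_Q : R := fine (mu hball).

Definition omega_Q : R := Q%:R * Omega_Q.

Definition hnorm_tuple (m : nat) (y : m.-tuple H) : R :=
  Num.sqrt (\sum_(j < m) hnorm (tnth y j) ^+ 2).

Definition radial (f : H -> R) : Prop :=
  forall x y : H, hnorm x = hnorm y -> f x = f y.

Definition wLnorm (w : H -> R) (p : R) (g : H -> \bar R) : \bar R :=
  ((\int[mu]_x (`|g x| `^ p * (w x)%:E)) `^ p^-1)%E.

Definition hweight (a : R) (x : H) : R := hnorm x `^ a.

(* Extended-real valued, so that no integrability is built in; the value at
   x = 0, where the operator is undefined, is irrelevant as {0} is null. *)
Definition hardy (m : nat) (f : 'I_m -> H -> R) (x : H) : \bar R :=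
  ((hnorm x ^+ (m * Q))^-1%R%:E *
   \int[power_measure mu m]_(y in [set y | (hnorm_tuple y <= hnorm x)%R])
     (\prod_(j < m) f j (tnth y j))%R%:E)%E.

Definition hardy_opnorm (m : nat) (q alpha : R) (qs alphas : 'I_m -> R) :
    \bar R :=
  let N j (g : H -> R) :=
    wLnorm (hweight (qs j * alphas j / q)) (qs j) (EFin \o g) in
  ereal_sup
    [set (wLnorm (hweight alpha) q (hardy f) / \prod_(j < m) N j (f j))%E
      | f in [set f : 'I_m -> H -> R | forall j,
          [/\ measurable_fun [set: H] (f j), radial (f j) &
              (0 < N j (f j) < +oo)%E]]].

End heisenberg.

(* Euler's integral; only meaningful for s > 0. *)
Definition Gamma (R : realType) (s : R) : R :=
  \int[lebesgue_measure]_(t in `]0, +oo[) (t `^ (s - 1) * expR (- t)).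

(* Main.v *)
Require Import Defs.
From HB Require Import structures.
From mathcomp Require Import all_boot all_order all_algebra.
From mathcomp Require Import all_classical all_reals all_analysis.
From mathcomp Require Import measurable_realfun ring lra.
Import Order.TTheory GRing.Theory Num.Theory.
Import numFieldNormedType.Exports.

Set Implicit Arguments.
Unset Strict Implicit.
Unset Printing Implicit Defensive.

Local Open Scope classical_set_scope.
Local Open Scope ring_scope.

(** By homogeneity and radiality, [hardy f x] is the integral over
    [|y|_h <= 1] of the product of the [f_j], evaluated at the dilation of [x]
    by [|y_j|_h].  Set [b_j = Q / q_j + alpha_j / q] and
    [h y = \prod_j |y_j|_h ^ (- b_j)].  The operator norm is the integral [K]
    of [h] over [|y|_h <= 1].
    - Upper bound: Hoelder in [y] against the weight [h], then Tonelli, then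
      Hoelder in [x] with exponents [q_j / q].
    - Lower bound: [f_j = |x|_h ^ (- b_j + eps q / q_j)] on the unit ball gives
      a ratio equal to the integral with [b_j] replaced by
      [b_j - eps q / q_j], which increases to [K] as [eps] decreases to 0.
    - Value of [K]: writing [exp (- s) = \int_(t > s) exp (- t) dt], the
      integral over all [y] of [h y * exp (- |y|_h ^ 2)] equals
      [K * Gamma (A / 2 + 1)], where [A = \sum_j (Q - b_j)]; on the other hand
      it is a product of [m] integrals of the same kind with [m = 1].  The
      same device gives the integrals of the powers of [|x|_h] on the unit
      ball, and [Gamma (s + 1) = s Gamma s]. *)

(** Why the weight [h] is the right one: [b_j] is the critical exponent. For the profile
    [|x|_h ^ (- b_j)] the integrand of the weighted [q_j]-norm is exactly [|x|_h ^ (- Q)], which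
    just fails to be integrable at the origin and at infinity. Since the [b_j] sum to
    [(Q + alpha) / q], the operator formally sends these powers to [K] times the critical power for
    the target space, so both Hoelder steps are formally equalities. The supremum is approached but
    the formal extremals are not admissible, hence the cutoff and [eps]. Polar coordinates are
    avoided altogether. Only the scaling of integrals under dilations is used, packaged in the
    record [homogeneous]. It is instantiated by the Heisenberg group and also by the half-line,
    where the same lemmas yield the functional equation of Gamma. The recurring obstacle is the
    origin, where powers take conventional values. Indicators of positive norm are therefore built
    into the integrands, and they are compared with the original ones only almost everywhere. *)

(** * Tonelli and coordinatewise changes of variables for finite power measures *)

Section power_measure_integral.
Context d (T : measurableType d) (R : realType).
Variable mu : {sigma_finite_measure set T -> \bar R}.
Local Open Scope ereal_scope.

Lemma ge0_integral_power_measureS m (f : m.+1.-tuple T -> \bar R) :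
  measurable_fun [set: m.+1.-tuple T] f -> (forall y, 0 <= f y) ->
  \int[power_measure mu m.+1]_y f y =
  \int[mu]_a \int[power_measure mu m]_t f (cons_pair (a, t)).
Proof.
move=> mf f0 /=.
have mc := @measurable_cons_pair d T m.
rewrite /cons_measure ge0_integral_pushforward//.
rewrite preimage_setT fubini_tonelli1//.
  exact: (measurableT_comp mf mc).
by move=> x; exact: f0.
Qed.

Lemma measurable_integral_cons_pair m (f : m.+1.-tuple T -> \bar R) :
  measurable_fun [set: m.+1.-tuple T] f -> (forall y, 0 <= f y) ->
  measurable_fun [set: T]
    (fun a => \int[power_measure mu m]_t f (cons_pair (a, t))).
Proof.
move=> mf f0.
apply: (@measurable_fun_fubini_tonelli_F _ _ T (m.-tuple T) R (power_measure mu m)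
  (fun p => f (cons_pair p))) => //.
exact: (measurableT_comp mf (@measurable_cons_pair d T m)).
Qed.

Lemma tnth_cons_pair0 m (a : T) (t : m.-tuple T) :
  tnth (cons_pair (a, t)) ord0 = a.
Proof. by rewrite /cons_pair tnth0. Qed.

Lemma tnth_cons_pairS m (a : T) (t : m.-tuple T) i :
  tnth (cons_pair (a, t)) (lift ord0 i) = tnth t i.
Proof. by rewrite /cons_pair tnthS. Qed.

Lemma ge0_integral_power_measure_prod m (g : 'I_m -> T -> R) :
  (forall j, measurable_fun [set: T] (g j)) -> (forall j x, (0 <= g j x)%R) ->
  \int[power_measure mu m]_y (\prod_(j < m) g j (tnth y j))%:E =
  \prod_(j < m) \int[mu]_x (g j x)%:E.
Proof.
elim: m g => [|m IH] g mg g0.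
  under eq_integral do rewrite big_ord0.
  by rewrite big_ord0 /= integral_dirac// diracT mul1e.
have mprod k (g' : 'I_k -> T -> R) :
    (forall j, measurable_fun [set: T] (g' j)) ->
    measurable_fun [set: k.-tuple T]
    (fun y => (\prod_(j < k) g' j (tnth y j))%:E).
  move=> mg'; apply/measurable_EFinP; apply: measurable_prod => j _.
  by apply: measurableT_comp => //; exact: measurable_tnth.
rewrite (ge0_integral_power_measureS (mprod _ _ mg)); last first.
  by move=> y; rewrite lee_fin; apply: prodr_ge0.
rewrite big_ord_recl -IH//.
rewrite -ge0_integralZr//; last 3 first.
- by apply/measurable_EFinP.
- by move=> x _; rewrite lee_fin.
- by apply: integral_ge0 => y _; rewrite lee_fin; apply: prodr_ge0.
apply: eq_integral => a _.
rewrite -ge0_integralZl//; last 3 first.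
- by apply: (@mprod m (fun j => g (lift ord0 j))).
- by move=> y _; rewrite lee_fin; apply: prodr_ge0.
- by rewrite lee_fin.
apply: eq_integral => t _.
rewrite big_ord_recl tnth_cons_pair0 EFinM; congr (_ * (_)%:E).
by apply: eq_bigr => j _; rewrite tnth_cons_pairS.
Qed.

Definition tuple_map_nth m (th : 'I_m -> T -> T) (y : m.-tuple T) : m.-tuple T :=
  [tuple th i (tnth y i) | i < m].

Lemma tnth_tuple_map_nth m (th : 'I_m -> T -> T) y i :
  tnth (tuple_map_nth th y) i = th i (tnth y i).
Proof. by rewrite tnth_mktuple. Qed.

Lemma measurable_tuple_map_nth m (th : 'I_m -> T -> T) :
  (forall i, measurable_fun [set: T] (th i)) ->
  measurable_fun [set: m.-tuple T] (tuple_map_nth th).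
Proof.
move=> mth; apply/measurable_fun_tnthP => i.
rewrite (_ : _ \o _ = th i \o (fun y => tnth y i)).
  by apply: measurableT_comp => //; exact: measurable_tnth.
by apply/funext => y /=; rewrite tnth_tuple_map_nth.
Qed.

(** Serves at two levels: for the anisotropic dilations of the Heisenberg group, whose coordinates
    are real numbers, and for the simultaneous dilation of a tuple of group elements. *)
Lemma ge0_integral_power_measure_map m (th : 'I_m -> T -> T) (c : 'I_m -> R)
    (f : m.-tuple T -> \bar R) :
  (forall i, measurable_fun [set: T] (th i)) -> (forall i, (0 <= c i)%R) ->
  (forall i (g : T -> \bar R), measurable_fun [set: T] g ->
     (forall x, 0 <= g x) ->
     \int[mu]_x g (th i x) = (c i)%:E * \int[mu]_x g x) ->
  measurable_fun [set: m.-tuple T] f -> (forall y, 0 <= f y) ->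
  \int[power_measure mu m]_y f (tuple_map_nth th y) =
  (\prod_(i < m) c i)%:E * \int[power_measure mu m]_y f y.
Proof.
elim: m th c f => [|m IH] th c f mth c0 hth mf f0.
  rewrite big_ord0 mul1e; apply: eq_integral => y _; congr f.
  by apply/eq_from_tnth => -[].
have mfth : measurable_fun [set: m.+1.-tuple T] (fun y => f (tuple_map_nth th y)).
  by exact: (measurableT_comp mf (measurable_tuple_map_nth mth)).
rewrite (ge0_integral_power_measureS mfth)// big_ord_recl EFinM -muleA.
rewrite (ge0_integral_power_measureS mf f0).
rewrite -ge0_integralZl//; last 3 first.
- exact: measurable_integral_cons_pair.
- by move=> x _; apply: integral_ge0.
- by rewrite lee_fin; apply: prodr_ge0.
(* The integral over the tail, as a function of the first coordinate, is itself an admissible [g]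
   for [th ord0]. *)
rewrite -(hth ord0 (fun a => _ * \int[_]_t f (cons_pair (a, t)))); last 2 first.
- by apply: measurable_funeM; exact: measurable_integral_cons_pair.
- move=> x; apply: mule_ge0; first by rewrite lee_fin; apply: prodr_ge0.
  exact: integral_ge0.
apply: eq_integral => a _.
rewrite -(IH (fun i => th (lift ord0 i)) (fun i => c (lift ord0 i)))//.
- apply: eq_integral => t _; congr f; apply/eq_from_tnth => i.
  case: (unliftP ord0 i) => [j|] ->.
    by rewrite tnth_tuple_map_nth !tnth_cons_pairS tnth_tuple_map_nth.
  by rewrite tnth_tuple_map_nth !tnth_cons_pair0.
- by move=> i g mg g0; apply: hth.
- have mp : measurable_fun [set: m.-tuple T] (fun t => cons_pair (th ord0 a, t)).
    exact: (measurableT_comp (@measurable_cons_pair d T m) (pair1_measurable (th ord0 a))).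
  exact: (measurableT_comp mf mp).
Qed.

(** The set is a box with [Z] in slot [j] and the whole space elsewhere; infinite factors do no harm
    since [0 * +oo = 0]. *)
Lemma power_measure_tnth_null m (Z : set T) : measurable Z -> mu Z = 0 ->
  forall j : 'I_m, power_measure mu m [set y | Z (tnth y j)] = 0.
Proof.
move=> mZ Z0 j.
transitivity (\prod_(i < m) mu (if i == j then Z else setT)); last first.
  by rewrite (bigD1 j)//= eqxx Z0 mul0e.
rewrite -(power_measure_box mu); last by move=> i; case: ifP.
congr (power_measure mu m _); apply/seteqP; split => y /=.
  by move=> Zy i; case: eqP => // ->.
by move=> /(_ j); rewrite eqxx.
Qed.

End power_measure_integral.

(** * Exponential integrals on the line and scaling of Lebesgue measure *)

Section calculus.
Context (R : realType).
Local Notation leb := (@lebesgue_measure R).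

Lemma measurable_fun_boolr d (T : measurableType d) (b : T -> bool) :
  measurable_fun [set: T] b ->
  measurable_fun [set: T] (fun x => (b x)%:R : R).
Proof.
move=> mb; rewrite (_ : (fun x => _) = (fun x => if b x then 1 else 0)).
  exact: measurable_fun_ifT.
by apply/funext => x; case: (b x).
Qed.

Lemma integral_setind d (T : measurableType d)
    (mu : {measure set T -> \bar R}) (P : T -> bool) (f : T -> R) :
  (\int[mu]_(x in [set x | P x]) (f x)%:E =
   \int[mu]_x ((P x)%:R * f x)%:E)%E.
Proof.
rewrite integral_mkcond; apply: eq_integral => x _.
rewrite patchE; case: ifPn; rewrite ?inE ?notin_setE/=.
  by move=> ->; rewrite mul1r.
by move=> /negP/negbTE ->; rewrite mul0r.
Qed.

Let derivable_expM (a s : R) : derivable (fun s => expR (a * s)) s 1.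
Proof. by apply: ex_derive. Qed.

Let derive_expM (a s : R) :
  derive1 (fun s => expR (a * s)) s = a * expR (a * s).
Proof.
rewrite derive1E.
have h : is_derive s 1 (fun s => expR (a * s)) (a * expR (a * s)).
  by apply: is_derive_eq; rewrite /GRing.scale/= mulr1 mulrC.
exact: derive_val.
Qed.

Let continuous_expM (a : R) : continuous (fun s => expR (a * s)).
Proof.
move=> s; apply: continuous_comp; last exact: continuous_expR.
by apply: cvgM; [exact: cvg_cst|exact: cvg_id].
Qed.

(** The flag [b] turns the strict inequality into a large one. Both forms are carried along because
    [hardy] integrates over closed balls while [Omega_Q] measures an open one. *)
Lemma integral_exp_tail (b : bool) (a u : R) : 0 < a ->
  (\int[leb]_s ((u < s ?<= if b)%R%:R * (a * expR (- a * s)))%:E =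
   (expR (- a * u))%:E)%E.
Proof.
move=> a0.
have cf : continuous (fun s => a * expR (- a * s)).
  by move=> s; apply: cvgM; [exact: cvg_cst|exact: continuous_expM].
transitivity (\int[leb]_(s in `[u, +oo[) (a * expR (- a * s))%:E)%E.
  rewrite -(@integral_setind _ _ leb (fun s => u < s ?<= if b)).
  case: b => /=.
    by rewrite set_itvcy.
  rewrite -integral_itv_obnd_cbnd; last first.
    by apply/measurable_EFinP; apply: measurable_funTS; exact: continuous_measurable_fun.
  by rewrite set_itvoy.
rewrite (@ge0_continuous_FTC2y _ _ (fun s => - expR (- a * s)) u 0).
- by rewrite sub0e EFinN oppeK.
- by move=> x _; rewrite mulr_ge0 ?expR_ge0// ltW.
- exact: continuous_subspaceT.
- rewrite -oppr0; apply: cvgN.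
  under eq_fun do rewrite mulNr.
  apply: (@cvg_comp _ _ _ (fun x => a * x) (fun x => expR (- x))); last exact: cvgr_expR.
  exact: gt0_cvgMry.
- by move=> x _; apply: derivableN.
- apply: cvgN; apply: cvg_at_right_filter; exact: continuous_expM.
- move=> x _.
  rewrite derive1E deriveN// -derive1E derive_expM.
  by rewrite mulNr opprK.
Qed.

(** Used with [L = - ln (N x)], where the right-hand side becomes [N x] to the power [- c], minus
    1. *)
Lemma integral_exp_segment (c L : R) : 0 <= L ->
  (\int[leb]_s ((0 < s < L)%R%:R * (c * expR (c * s)))%:E =
   (expR (c * L) - 1)%:E)%E.
Proof.
have cf : continuous (fun s => c * expR (c * s)).
  by move=> s; apply: cvgM; [exact: cvg_cst|exact: continuous_expM].
rewrite le_eqVlt => /predU1P[<-|L0].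
  rewrite mulr0 expR0 subrr; apply: integral0_eq => s _.
  by case: (ltgtP s 0) => ?; rewrite ?andbF mul0r.
rewrite -(@integral_setind _ _ leb (fun s => 0 < s < L)).
transitivity (\int[leb]_(s in `[0%R, L]) (c * expR (c * s))%:E)%E.
  rewrite (@integral_itv_bndoo _ 0 L _ true false); last first.
    by apply/measurable_EFinP; apply: measurable_funTS; exact: continuous_measurable_fun.
  by rewrite set_itvoo.
rewrite (@continuous_FTC2 _ _ (fun s => expR (c * s)) 0 L)//.
- by rewrite mulr0 expR0.
- exact: continuous_subspaceT.
- split.
  + by move=> x _.
  + apply: cvg_at_right_filter; exact: continuous_expM.
  + apply: cvg_at_left_filter; exact: continuous_expM.
Qed.

Lemma lebesgue_measure_scale (r : R) (A : set R) : 0 < r -> measurable A ->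
  leb A = (r%:E * leb ((fun x => r * x)%R @^-1` A))%E.
Proof.
move=> r0 mA.
have r0' : 0 <= r by exact: ltW.
pose g (x : measurableTypeR R) : measurableTypeR R := r * x.
have mr : measurable_fun [set: measurableTypeR R] g by exact: measurable_funM.
rewrite [LHS](@lebesgue_measure_unique R (mscale (NngNum r0') (pushforward leb g)))//.
move=> _ [[a b] _ <-].
transitivity (r%:E * leb (g @^-1` [set` `]a, b]]))%E; last by [].
rewrite (_ : _ @^-1` _ = [set` `]a / r, b / r]]); last first.
  apply/seteqP; split => x /=; rewrite !in_itv/= /g ltr_pdivrMr// ler_pdivlMr//;
    by rewrite (mulrC x).
rewrite lebesgue_measure_itv/= lebesgue_measure_itv/= !lte_fin ltr_pM2r ?invr_gt0//.
case: ifPn => _; last by rewrite mule0.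
by rewrite -!EFinB -EFinM; congr (_%:E); rewrite -mulrBl mulrCA divff ?gt_eqF// mulr1.
Qed.

Lemma integral_lebesgue_scale (r : R) (f : R -> \bar R) : 0 < r ->
  measurable_fun [set: R] f -> (forall x, 0 <= f x)%E ->
  (\int[leb]_x f (r * x)%R = (r^-1)%:E * \int[leb]_x f x)%E.
Proof.
move=> r0 mf f0.
have r0' : 0 <= r by exact: ltW.
pose g (x : measurableTypeR R) : measurableTypeR R := r * x.
have mr : measurable_fun [set: measurableTypeR R] g by exact: measurable_funM.
have h A : measurable A -> A `<=` setT ->
    leb A = mscale (NngNum r0') (pushforward leb g) A.
  by move=> mA _; exact: lebesgue_measure_scale.
rewrite [in RHS](eq_measure_integral _ (h mr)).
rewrite ge0_integral_mscale// ge0_integral_pushforward// preimage_setT.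
by rewrite muleA -EFinM mulVf ?gt_eqF// mul1e.
Qed.

End calculus.

(** * Layer-cake formulas and the extended-real Gamma integral *)

Section layer_cake.
Context (R : realType).
Local Notation leb := (@lebesgue_measure R).
Local Open Scope ereal_scope.

(** Tonelli, once [G y] is written as an integral of [g] over a section of [P]. This representation
    is asked for only where [W] is positive: in [ball_powD] it fails at the origin and outside the
    closed unit ball. *)
Lemma layer_cake d (Y : measurableType d)
    (nu : {sigma_finite_measure set Y -> \bar R}) (W G : Y -> R) (g : R -> R)
    (P : Y -> R -> bool) :
  measurable_fun [set: Y] W -> (forall y, (0 <= W y)%R) ->
  measurable_fun [set: R] g -> (forall s, (0 <= g s)%R) ->
  measurable_fun [set: Y * R] (fun p => P p.1 p.2) ->
  (forall y, (0 < W y)%R -> \int[leb]_s ((P y s)%:R * g s)%:E = (G y)%:E) ->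
  \int[nu]_y (W y * G y)%:E =
  \int[leb]_s ((g s)%:E * \int[nu]_y ((P y s)%:R * W y)%:E).
Proof.
move=> mW W0 mg g0 mP hG.
pose k (p : Y * R) := (W p.1 * ((P p.1 p.2)%:R * g p.2))%:E.
have mk : measurable_fun [set: Y * R] k.
  apply/measurable_EFinP; apply: measurable_funM.
    exact: (measurableT_comp mW measurable_fst).
  apply: measurable_funM; first exact: measurable_fun_boolr.
  exact: (measurableT_comp mg measurable_snd).
have k0 p : 0 <= k p by rewrite lee_fin !mulr_ge0.
have mP1 y : measurable_fun [set: R] (fun s => P y s).
  exact: (measurableT_comp mP (pair1_measurable y)).
have mP2 s : measurable_fun [set: Y] (fun y => P y s).
  exact: (measurableT_comp mP (pair2_measurable s)).
transitivity (\int[nu]_y \int[leb]_s k (y, s)).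
  apply: eq_integral => y _; rewrite /k/=.
  have [Wy|] := ltP 0%R (W y).
    rewrite EFinM -hG// -ge0_integralZl//.
    - apply/measurable_EFinP; apply: measurable_funM => //.
      exact: (measurable_fun_boolr (mP1 y)).
    - by move=> s _; rewrite lee_fin mulr_ge0.
    - by rewrite lee_fin.
  move=> Wy; have -> : W y = 0%R by apply/eqP; rewrite eq_le Wy W0.
  by rewrite mul0r; under eq_integral do rewrite mul0r; rewrite integral0.
rewrite fubini_tonelli//; apply: eq_integral => s _; rewrite /k/=.
rewrite -ge0_integralZl//.
- by apply: eq_integral => y _; rewrite -EFinM; congr (_%:E); ring.
- apply/measurable_EFinP; apply: measurable_funM => //.
  exact: (measurable_fun_boolr (mP2 s)).
- by move=> y _; rewrite lee_fin mulr_ge0.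
- by rewrite lee_fin.
Qed.

(** Extended-real, so that the identities below can be proved before finiteness is known; finiteness
    is itself derived from one of them. *)
Definition gammae (s : R) : \bar R :=
  \int[leb]_t ((0 < t)%R%:R * (t `^ (s - 1) * expR (- t)))%:E.

Lemma GammaE (s : R) : Gamma s = fine (gammae s).
Proof.
rewrite /Gamma /Rintegral /gammae.
rewrite -(@integral_setind _ _ _ leb (fun t => 0 < t)%R).
by rewrite set_itvoy.
Qed.

Lemma integral_expRN_layer (b : bool) d (Y : measurableType d)
    (nu : {sigma_finite_measure set Y -> \bar R}) (W rho : Y -> R) (sg : R)
    (C : \bar R) :
  measurable_fun [set: Y] W -> (forall y, (0 <= W y)%R) ->
  measurable_fun [set: Y] rho -> (forall y, (0 <= rho y)%R) ->
  0 <= C ->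
  (forall v, (0 < v)%R ->
     \int[nu]_y ((rho y < v ?<= if b)%R%:R * W y)%:E = (v `^ sg)%:E * C) ->
  \int[nu]_y (W y * expR (- rho y))%:E = C * gammae (sg + 1).
Proof.
move=> mW W0 mrho rho0 C0 h.
have mb : measurable_fun [set: Y * R]
    (fun p => (rho p.1 < p.2 ?<= if b)%R).
  have m1 : measurable_fun [set: Y * R] (rho \o fst).
    exact: (measurableT_comp mrho measurable_fst).
  by case: (b); [apply: measurable_fun_ler|apply: measurable_fun_ltr].
have me : measurable_fun [set: R] (fun s => expR (- s)).
  by apply: measurableT_comp.
(* The extra condition [0 < p.2] is there because the scaling hypothesis is available for positive
   levels only. *)
have mP : measurable_fun [set: Y * R]
    (fun p => (rho p.1 < p.2 ?<= if b) && (0 < p.2))%R.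
  apply: measurable_and => //; apply: measurable_fun_ltr => //.
have e0 (s : R) : (0 <= expR (- s))%R by rewrite expR_ge0.
rewrite (@layer_cake _ Y nu W _ (fun s => expR (- s))
  (fun y s => (rho y < s ?<= if b) && (0 < s))%R)//; last first.
- move=> y _; rewrite -(mulN1r (rho y)).
  (* At [rho y = 0] the condition [0 < s] makes the inequality strict whatever [b] is, so the flag
     has to be switched off there. *)
  rewrite -(integral_exp_tail (b && (0 < rho y)%R))//.
  apply: eq_integral => s _; rewrite mul1r mulN1r; congr (((nat_of_bool _)%:R * _)%:E).
  have := rho0 y; rewrite le_eqVlt => /predU1P[<-|r0].
    by rewrite ltxx andbF/=; case: (b) => /=; case: ltgtP.
  rewrite r0 andbT; case: (b) => /=; case: (ltP 0%R s) => s0; rewrite ?andbT ?andbF//.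
    by apply/esym/negbTE; rewrite -ltNge (le_lt_trans s0).
  by apply/esym/negbTE; rewrite -leNgt (le_trans s0)// ltW.
transitivity (\int[leb]_s (C * ((0 < s)%R%:R * (s `^ (sg + 1 - 1) * expR (- s)))%:E)).
  apply: eq_integral => s _.
  have [s0|s0] := ltP 0%R s; last first.
    rewrite mul0r mule0; under eq_integral do rewrite andbF mul0r.
    by rewrite integral0 mule0.
  under eq_integral do rewrite andbT.
  by rewrite h// mul1r addrK muleA -EFinM muleC mulrC.
rewrite ge0_integralZl//.
- apply/measurable_EFinP; apply: measurable_funM.
    by apply: measurable_fun_boolr; exact: measurable_fun_ltr.
  by apply: measurable_funM => //; exact: measurable_powR.
- by move=> s _; rewrite lee_fin mulr_ge0// mulr_ge0 ?powR_ge0 ?expR_ge0.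
Qed.

End layer_cake.

(** The last field is the change of variables for nonnegative functions: a dilation by [r]
    multiplies volumes by [r] to the power [Q]. No group law is involved, and the norm may vanish
    away from the origin, as it does for the half-line. *)
Record homogeneous d (T : measurableType d) (R : realType)
    (mu : {measure set T -> \bar R}) (Q : R) (N : T -> R)
    (dil : R -> T -> T) : Prop := Homogeneous {
  homog_dim_gt0 : 0 < Q ;
  homog_measurable_norm : measurable_fun [set: T] N ;
  homog_norm_ge0 : forall x, 0 <= N x ;
  homog_norm_dil : forall r x, 0 < r -> N (dil r x) = r * N x ;
  homog_measurable_dil : forall r, 0 < r -> measurable_fun [set: T] (dil r) ;
  homog_integral_dil : forall r (f : T -> \bar R), 0 < r ->
    measurable_fun [set: T] f -> (forall x, 0 <= f x)%E ->
    (\int[mu]_x f (dil r x) = (r `^ (- Q))%:E * \int[mu]_x f x)%E }.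

Lemma gt0_powRD (R : realType) (x r s : R) : 0 < x ->
  x `^ (r + s) = x `^ r * x `^ s.
Proof. by move=> x0; rewrite powRD//; apply/implyP => _; rewrite gt_eqF. Qed.

(** * Powers of a homogeneous norm integrated over balls *)

Section homogeneous_theory.
Context d (T : measurableType d) (R : realType).
Variables (mu : {sigma_finite_measure set T -> \bar R}) (Q : R) (N : T -> R)
  (dil : R -> T -> T).
Hypothesis hT : homogeneous mu Q N dil.
Local Notation leb := (@lebesgue_measure R).

Let Q0 : 0 < Q := homog_dim_gt0 hT.
Let mN : measurable_fun [set: T] N := homog_measurable_norm hT.
Let N0 : forall x, 0 <= N x := homog_norm_ge0 hT.

(* The factor [0 < N x] makes the homogeneity exact at the origin as well,
   whatever the value of [0 `^ (a - Q)]. *)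
Definition norm_pow (a : R) (x : T) : R := (0 < N x)%R%:R * N x `^ (a - Q).

Lemma measurable_norm_pow a : measurable_fun [set: T] (norm_pow a).
Proof.
apply: measurable_funM.
  by apply: measurable_fun_boolr; exact: measurable_fun_ltr.
exact: (measurableT_comp (measurable_powR _) mN).
Qed.

Lemma norm_pow_ge0 a x : 0 <= norm_pow a x.
Proof. by rewrite mulr_ge0// powR_ge0. Qed.

Lemma norm_pow_gt0 a x : (0 < norm_pow a x) = (0 < N x).
Proof.
rewrite /norm_pow; case: (boolP (0 < N x)) => [Nx|_].
  by rewrite mul1r powR_gt0.
by rewrite mul0r ltxx.
Qed.

Lemma norm_pow_dil a r x : 0 < r ->
  norm_pow a (dil r x) = r `^ (a - Q) * norm_pow a x.
Proof.
move=> r0; rewrite /norm_pow (homog_norm_dil hT)// pmulr_rgt0//.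
by rewrite powRM// ?ltW//; ring.
Qed.

Definition ball_pow (a : R) : \bar R :=
  (\int[mu]_x ((N x < 1)%R%:R * norm_pow a x)%:E)%E.

Let measurable_ball_norm_pow a r :
  measurable_fun [set: T] (fun x => ((N x < r)%R%:R * norm_pow a x)%:E).
Proof.
apply/measurable_EFinP; apply: measurable_funM; last exact: measurable_norm_pow.
by apply: measurable_fun_boolr; exact: measurable_fun_ltr.
Qed.

Lemma ball_pow_ge0 a : (0 <= ball_pow a)%E.
Proof.
by apply: integral_ge0 => x _; rewrite lee_fin mulr_ge0// norm_pow_ge0.
Qed.

Lemma integral_ball_norm_pow a r : 0 < r ->
  (\int[mu]_x ((N x < r)%R%:R * norm_pow a x)%:E = (r `^ a)%:E * ball_pow a)%E.
Proof.
move=> r0.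
have := @homog_integral_dil _ _ _ _ _ _ _ hT r _ r0 (measurable_ball_norm_pow a r).
move=> /(_ _)/wrap[|h].
  by move=> x; rewrite lee_fin mulr_ge0// norm_pow_ge0.
have r1 : (r `^ a = r `^ Q * r `^ (a - Q))%R.
  by rewrite -gt0_powRD//; congr powR; ring.
rewrite r1 EFinM -muleA -ge0_integralZl_EFin ?powR_ge0//; last first.
  by move=> x _; rewrite lee_fin mulr_ge0// norm_pow_ge0.
rewrite -[LHS]mul1e -[X in (X%:E * _)%E](_ : r `^ Q * r `^ (- Q) = 1)%R; last first.
  by rewrite -gt0_powRD// subrr powRr0.
rewrite EFinM -muleA -h; congr (_ * _)%E; apply: eq_integral => x _.
rewrite (homog_norm_dil hT)// norm_pow_dil// -EFinM; congr (_%:E).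
by rewrite -[X in _ < X]mulr1 ltr_pM2l//; ring.
Qed.

(** On the punctured unit ball, [N^(a-Q) = N^(a+c-Q) * (1 + (N^(-c) - 1))], and [N^(-c) - 1] is the
    integral of [c * exp (c s)] over [0 < s < - ln N]. For fixed [s] this restricts [x] to the ball
    of radius [exp (- s)], whose integral scales by [exp (- (a + c) s)]. What remains is the
    integral of [c * exp (- a s)], that is [c / a]; the total factor is [1 + c / a]. *)
Lemma ball_powD a c : 0 < a -> 0 < c ->
  ball_pow a = (((a + c) / a)%:E * ball_pow (a + c))%E.
Proof.
move=> a0 c0.
pose W x := (N x < 1)%R%:R * norm_pow (a + c) x.
have mW : measurable_fun [set: T] W.
  by apply/measurable_EFinP; exact: measurable_ball_norm_pow.
have W0 x : 0 <= W x by rewrite mulr_ge0// norm_pow_ge0.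
pose g s := c * expR (c * s).
have mg : measurable_fun [set: R] g.
  apply: measurable_funM => //.
  by apply: (measurableT_comp (@measurable_expR R)); exact: mulrl_measurable.
have g0 s : 0 <= g s by rewrite mulr_ge0 ?expR_ge0// ltW.
pose P x s := 0 < s < - ln (N x).
have mP : measurable_fun [set: T * R] (fun p => P p.1 p.2).
  apply: measurable_and; apply: measurable_fun_ltr => //.
  apply: (measurableT_comp (@oppr_measurable R setT)).
  apply: (measurableT_comp (@measurable_ln R)).
  exact: (measurableT_comp mN measurable_fst).
have NW x : 0 < W x -> 0 < N x < 1.
  rewrite /W; case: (ltP (N x) 1); last by rewrite mul0r ltxx.
  by rewrite mul1r norm_pow_gt0 andbT.
have lc := @layer_cake R _ T mu W (fun x => N x `^ (- c) - 1) g P mW W0 mg g0 mP.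
have {}lc := lc _.
rewrite {1}/ball_pow.
transitivity (\int[mu]_x ((W x)%:E + (W x * (N x `^ (- c) - 1))%:E))%E.
  apply: eq_integral => x _; rewrite -EFinD; congr (_%:E).
  rewrite /W /norm_pow.
  case: (ltP 0 (N x)) => Nx; last by rewrite !mul0r !mulr0 mul0r addr0.
  have -> : N x `^ (a - Q) = N x `^ (a + c - Q) * N x `^ (- c).
    by rewrite -gt0_powRD//; congr powR; ring.
  ring.
rewrite ge0_integralD//; last 4 first.
- by move=> x _; rewrite lee_fin.
- exact/measurable_EFinP.
- move=> x _; rewrite lee_fin.
  have := W0 x; rewrite le_eqVlt => /predU1P[<-|/NW/andP[Nx Nx1]].
    by rewrite mul0r.
  rewrite mulr_ge0// subr_ge0 powRN -[leLHS]invr1 lef_pV2 ?posrE ?powR_gt0//.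
  suff: N x `^ c <= 1 `^ c by rewrite powR1.
  by rewrite ge0_ler_powR ?nnegrE ?ltW.
- apply/measurable_EFinP; apply: measurable_funM => //.
  apply: measurable_funB => //.
  exact: (measurableT_comp (measurable_powR _) mN).
rewrite lc; last first.
  move=> x /NW/andP[Nx Nx1]; rewrite /P /g integral_exp_segment//; last first.
    by rewrite oppr_ge0 ln_le0// ltW.
  congr (_%:E); congr (_ - _); rewrite /powR gt_eqF//; congr expR; ring.
pose e s := (0 < s)%R%:R * (a * expR (- a * s)).
have me : measurable_fun [set: R] e.
  apply: measurable_funM.
    by apply: measurable_fun_boolr; exact: measurable_fun_ltr.
  apply: measurable_funM => //.
  by apply: (measurableT_comp (@measurable_expR R)); exact: mulrl_measurable.
have me0 s : 0 <= e s by rewrite mulr_ge0// mulr_ge0 ?expR_ge0 ?ltW.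
transitivity (ball_pow (a + c) +
   ball_pow (a + c) * \int[leb]_s (c / a * e s)%:E)%E.
  congr (_ + _)%E.
  rewrite -ge0_integralZl//; last 3 first.
  - exact/measurable_EFinP/measurable_funM.
  - by move=> s _; rewrite lee_fin mulr_ge0 ?divr_ge0 ?(ltW a0) ?(ltW c0)// me0.
  - exact: ball_pow_ge0.
  apply: eq_integral => s _.
  have [s0|s0] := ltP 0 s; last first.
    under eq_integral do rewrite /P ltNge s0 mul0r.
    by rewrite integral0 !mule0 /e ltNge s0 mul0r mulr0 mule0.
  transitivity ((g s)%:E * \int[mu]_x ((N x < expR (- s))%R%:R * norm_pow (a + c) x)%:E)%E.
    congr (_ * _)%E; apply: eq_integral => x _; congr (_%:E).
    rewrite /P s0/= /W /norm_pow.
    case: (ltP 0 (N x)) => Nx; last by rewrite mul0r !mulr0.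
    rewrite ltrNr -[in RHS](lnK Nx) ltr_expR.
    case: (ltP (ln (N x))) => h; last by rewrite !mul0r.
    have -> : N x < 1.
      by rewrite -ltr_ln ?posrE// ln1 (lt_trans h)// oppr_lt0.
    by rewrite !mul1r lnK.
  rewrite integral_ball_norm_pow ?expR_gt0//.
  rewrite muleA -EFinM muleC; congr (_ * _%:E)%E.
  rewrite /g /e s0 mul1r -expRM mulrA divfK ?gt_eqF//.
  have -> : - a * s = c * s + - s * (a + c) by ring.
  by rewrite expRD mulrA; ring.
have -> : (\int[leb]_s (c / a * e s)%:E = (c / a)%:E)%E.
  under eq_integral do rewrite EFinM.
  rewrite ge0_integralZl_EFin//.
  - by rewrite (integral_exp_tail false 0 a0) mulr0 expR0 mule1.
  - by move=> s _; rewrite lee_fin.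
  - exact/measurable_EFinP.
  - by rewrite divr_ge0// ltW.
rewrite muleC -{1}[ball_pow _]mul1e -ge0_muleDl ?lee_fin ?divr_ge0 ?ltW//.
by rewrite -EFinD mulrDl divff ?gt_eqF.
Qed.

(** By [ball_powD] the product of [a] and [ball_pow a] is constant; two cases arise because that
    lemma only raises the exponent. *)
Lemma ball_powE a : 0 < a -> ball_pow a = ((Q / a)%:E * ball_pow Q)%E.
Proof.
move=> a0; case: (ltgtP a Q) => [aQ|aQ|->]; last by rewrite divff ?mul1e ?gt_eqF.
  by rewrite (@ball_powD a (Q - a)) ?subr_gt0// addrC subrK.
rewrite (@ball_powD Q (a - Q)) ?subr_gt0// addrC subrK muleA -EFinM.
by rewrite mulrA divfK ?gt_eqF// divff ?gt_eqF// mul1e.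
Qed.

End homogeneous_theory.

(** * Functional equation, finiteness and positivity of Gamma *)

Section gamma.
Context (R : realType).
Local Notation leb := (@lebesgue_measure R).
Local Notation N := (fun t : measurableTypeR R => Num.max 0 t : R).

Let maxr0_gt0 (t : R) : (0 < Num.max 0 t) = (0 < t).
Proof. by rewrite lt_max ltxx. Qed.

(** The half-line as a homogeneous space of dimension 1: nonpositive numbers get norm 0, and the
    indicator inside [norm_pow] discards them. *)
Lemma homogeneous_lebesgue : homogeneous leb 1 N (fun r (t : measurableTypeR R) => (r * t : R)).
Proof.
split => //.
- exact: measurable_maxr.
- by move=> t; rewrite le_max lexx.
- by move=> r t r0; rewrite maxr_pMr ?ltW// mulr0.
- by move=> r _; exact: mulrl_measurable.
- move=> r f r0 mf f0; rewrite integral_lebesgue_scale//.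
  by rewrite powR_inv1// ltW.
Qed.

Let norm_powE s (t : R) : @norm_pow _ (measurableTypeR R) R 1 N s t = (0 < t)%R%:R * t `^ (s - 1).
Proof.
rewrite /norm_pow maxr0_gt0; case: (ltP 0 t) => t0; last by rewrite !mul0r.
by [].
Qed.

Let ball_pow_lebesgue1 : ball_pow leb 1 N 1 = 1%E.
Proof.
rewrite /ball_pow.
transitivity (\int[leb]_x ((x \in `]0%R, 1[)%:R * 1)%:E)%E.
  apply: eq_integral => t _; rewrite norm_powE subrr powRr0 in_itv/=.
  case: (ltP 0 t) => t0; last by rewrite mul0r mulr0.
  by rewrite ?max_r ?ltW// !mulr1.
rewrite -(@integral_setind _ _ _ leb (fun x => x \in `]0%R, 1[)).
rewrite integral_cst//= mul1e lebesgue_measure_itv/= lte_fin ltr01.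
by rewrite oppr0 adde0.
Qed.

(** No integration by parts: the layer-cake formula on the half-line gives
    [ball_pow s * gammae (s + 1)], and there [ball_pow s] equals [1 / s]. *)
Lemma gammaeS (s : R) : 0 < s -> gammae s = ((s^-1)%:E * gammae (s + 1))%E.
Proof.
move=> s0; have hh := homogeneous_lebesgue.
have mW := measurable_norm_pow hh s.
have W0 := @norm_pow_ge0 _ (measurableTypeR R) R 1 N s.
transitivity (\int[leb]_t (norm_pow 1 N s t * expR (- N t))%:E)%E.
  apply: eq_integral => t _; congr (_%:E); rewrite norm_powE.
  case: (ltP 0 t) => t0; last by rewrite !mul0r.
  by rewrite ?max_r ?ltW// !mul1r.
rewrite (@integral_expRN_layer R false _ _ leb _ N s (ball_pow leb 1 N s) mW W0
  (homog_measurable_norm hh) (homog_norm_ge0 hh) (ball_pow_ge0 _ _ _ _)).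
  by rewrite (ball_powE hh)// ball_pow_lebesgue1 mul1r mule1.
by move=> v v0; exact: (integral_ball_norm_pow hh).
Qed.

Let mgammae (s : R) : measurable_fun [set: R]
  (fun t => ((0 < t)%R%:R * (t `^ (s - 1) * expR (- t)))%:E).
Proof.
apply/measurable_EFinP; apply: measurable_funM.
  by apply: measurable_fun_boolr; exact: measurable_fun_ltr.
apply: measurable_funM; first exact: measurable_powR.
exact: (measurableT_comp (@measurable_expR R)).
Qed.

Let mtail (a k u : R) : measurable_fun [set: R]
  (fun t => (k * ((u < t)%R%:R * (a * expR (- a * t))))%:E).
Proof.
apply/measurable_EFinP; apply: measurable_funM => //; apply: measurable_funM.
  by apply: measurable_fun_boolr; exact: measurable_fun_ltr.
apply: measurable_funM => //.
by apply: (measurableT_comp (@measurable_expR R)); exact: mulrl_measurable.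
Qed.

Lemma gammaeS_lty (s : R) : 0 < s -> (gammae (s + 1) < +oo)%E.
Proof.
(* From [ln x < x] at [x = t / (2 s)] one gets [t^s <= (2 s)^s * exp (t / 2)], so the integrand is
   at most [(2 s)^s * exp (- t / 2)]. The leading 2 compensates the normalising factor 1/2 of
   [integral_exp_tail]. *)
move=> s0; pose k := 2 * (2 * s) `^ s.
have k0 : 0 <= k by rewrite mulr_ge0// powR_ge0.
apply: (@le_lt_trans _ _
  (\int[leb]_t (k * ((0 < t)%R%:R * (2^-1 * expR (- 2^-1 * t))))%:E)%E).
  apply: ge0_le_integral => //.
  - by move=> t _; rewrite lee_fin mulr_ge0// mulr_ge0 ?powR_ge0 ?expR_ge0.
  - exact: mgammae.
  - by have := mtail 2^-1 k 0.
  - move=> t _; rewrite lee_fin; have [t0|t0] := ltP 0 t; last by rewrite !mul0r mulr0.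
    rewrite !mul1r addrK /k [leRHS](_ : _ = (2 * s) `^ s * expR (- 2^-1 * t)); last first.
      by field.
    have -> : - t = t / 2 * (-1) + - 2^-1 * t by field.
    rewrite expRD mulrA ler_pM2r ?expR_gt0// mulrN1 expRN ler_pdivrMr ?expR_gt0//.
    have s2 : 0 < 2 * s by rewrite mulr_gt0.
    rewrite /powR (gt_eqF t0) (gt_eqF s2) -expRD ler_expR.
    have := ln_sublinear (divr_gt0 t0 s2); rewrite ln_div ?posrE// => h.
    rewrite -lerBlDl -mulrBr; apply: le_trans (_ : s * (t / (2 * s)) <= _).
      by rewrite ler_pM2l// ltW.
    by rewrite le_eqVlt; apply/orP; left; apply/eqP; field; rewrite gt_eqF.
under eq_integral do rewrite EFinM.
rewrite ge0_integralZl_EFin//.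
- by rewrite (integral_exp_tail false) ?invr_gt0// -EFinM ltry.
- by have := mtail 2^-1 1 0; under eq_fun do rewrite mul1r.
Qed.

Lemma gammaeS_gt0 (s : R) : 0 < s -> (0 < gammae (s + 1))%E.
Proof.
move=> s0; apply: (@lt_le_trans _ _
  (\int[leb]_t (1 * ((1 < t)%R%:R * (1 * expR (- 1 * t))))%:E)%E).
  under eq_integral do rewrite mul1r.
  by rewrite (integral_exp_tail false)// lte_fin expR_gt0.
apply: ge0_le_integral => //.
- exact: mtail.
- exact: mgammae.
- move=> t _; rewrite lee_fin mul1r; have [t1|t1] := ltP 1 t; last first.
    by rewrite mul0r mulr_ge0// mulr_ge0 ?powR_ge0 ?expR_ge0.
  rewrite (lt_trans ltr01 t1) !mul1r mulN1r addrK ler_peMl ?expR_ge0//.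
  suff: t `^ 0 <= t `^ s by rewrite powRr0.
  by apply: ler_powR; exact: ltW.
Qed.

Lemma gammae_fin (s : R) : 0 < s -> gammae s = (Gamma s)%:E.
Proof.
move=> s0; rewrite GammaE fineK// gammaeS// fin_numM//.
by rewrite gt0_fin_numE ?gammaeS_lty// gammaeS_gt0.
Qed.

Lemma Gamma_gt0 (s : R) : 0 < s -> 0 < Gamma s.
Proof.
move=> s0; rewrite -lte_fin -gammae_fin// gammaeS// mule_gt0 ?gammaeS_gt0//.
by rewrite lte_fin invr_gt0.
Qed.

Lemma GammaS (s : R) : 0 < s -> Gamma (s + 1) = s * Gamma s.
Proof.
move=> s0; apply: EFin_inj; rewrite EFinM -!gammae_fin ?addr_gt0//.
by rewrite [in RHS]gammaeS// muleA -EFinM divff ?gt_eqF// mul1e.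
Qed.

End gamma.

(** * Products of powers over the unit ball of tuples, and the value of the constant *)

Section homogeneous_power.
Context d (T : measurableType d) (R : realType).
Variables (mu : {sigma_finite_measure set T -> \bar R}) (Q : R) (N : T -> R)
  (dil : R -> T -> T) (m : nat).
Hypothesis hT : homogeneous mu Q N dil.
Local Notation pw := (power_measure mu m).

Let mN : measurable_fun [set: T] N := homog_measurable_norm hT.
Let N0 : forall x, 0 <= N x := homog_norm_ge0 hT.

Definition sqnorm (y : m.-tuple T) : R := \sum_(j < m) N (tnth y j) ^+ 2.

Definition dil_tuple r (y : m.-tuple T) : m.-tuple T :=
  tuple_map_nth (fun=> dil r) y.

Definition prod_pow (a : 'I_m -> R) (y : m.-tuple T) : R :=
  \prod_(j < m) norm_pow Q N (a j) (tnth y j).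

Lemma measurable_fun_tnth_comp d' (U : measurableType d') (g : T -> U) j :
  measurable_fun [set: T] g ->
  measurable_fun [set: m.-tuple T] (fun y => g (tnth y j)).
Proof. by move=> mg; exact: (measurableT_comp mg (measurable_tnth j)). Qed.

Lemma measurable_sqnorm : measurable_fun [set: m.-tuple T] sqnorm.
Proof.
apply: measurable_sum => j; apply: measurable_funX.
exact: measurable_fun_tnth_comp.
Qed.

Lemma sqnorm_ge0 y : 0 <= sqnorm y.
Proof. by apply: sumr_ge0 => j _; rewrite sqr_ge0. Qed.

Lemma measurable_prod_pow a : measurable_fun [set: m.-tuple T] (prod_pow a).
Proof.
apply: measurable_prod => j _.
by apply: measurable_fun_tnth_comp; exact: (measurable_norm_pow hT).
Qed.

Lemma prod_pow_ge0 a y : 0 <= prod_pow a y.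
Proof. by apply: prodr_ge0 => j _; exact: norm_pow_ge0. Qed.

Lemma sqnorm_dil r y : 0 < r -> sqnorm (dil_tuple r y) = r ^+ 2 * sqnorm y.
Proof.
move=> r0; rewrite /sqnorm mulr_sumr; apply: eq_bigr => j _.
by rewrite tnth_tuple_map_nth (homog_norm_dil hT)// exprMn.
Qed.

Lemma ge0_integral_dil_tuple r (f : m.-tuple T -> \bar R) : 0 < r ->
  measurable_fun [set: m.-tuple T] f -> (forall y, 0 <= f y)%E ->
  (\int[pw]_y f (dil_tuple r y) = (r `^ (- (m%:R * Q)))%:E * \int[pw]_y f y)%E.
Proof.
move=> r0 mf f0.
rewrite (ge0_integral_power_measure_map (c := fun=> r `^ (- Q)))//.
- by rewrite prodr_const card_ord -powR_mulrn ?powR_ge0// -powRrM mulNr mulrC.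
- by move=> i; exact: (homog_measurable_dil hT).
- by move=> i; exact: powR_ge0.
- by move=> i g mg g0; exact: (homog_integral_dil hT).
Qed.

Lemma prod_pow_dil a r y : 0 < r ->
  prod_pow a (dil_tuple r y) =
  r `^ (\sum_(j < m) a j - m%:R * Q) * prod_pow a y.
Proof.
move=> r0; have -> : \sum_(j < m) a j - m%:R * Q = \sum_(j < m) (a j - Q).
  by rewrite sumrB sumr_const card_ord -[RHS]/(_ - _ *+ _) mulr_natl.
rewrite /prod_pow.
under eq_bigr do rewrite tnth_tuple_map_nth (norm_pow_dil hT)//.
rewrite big_split/=; congr (_ * _).
elim/big_rec2 : _ => [|j u v _ ->]; first by rewrite powRr0.
by rewrite -gt0_powRD.
Qed.

Let mball (b : bool) (a : 'I_m -> R) v : measurable_fun [set: m.-tuple T]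
  (fun y => ((sqnorm y < v ?<= if b)%R%:R * prod_pow a y)%:E).
Proof.
apply/measurable_EFinP; apply: measurable_funM; last exact: measurable_prod_pow.
apply: measurable_fun_boolr; have := measurable_sqnorm.
by case: b => mq; [apply: measurable_fun_ler|apply: measurable_fun_ltr].
Qed.

(** Dilation by the square root of [v]: the integrand has degree [A - m Q] and the measure
    contributes [m Q], whence the power [A / 2] of [v]. *)
Lemma integral_sqball_prod_pow b a v : 0 < v ->
  (\int[pw]_y ((sqnorm y < v ?<= if b)%R%:R * prod_pow a y)%:E =
   (v `^ ((\sum_(j < m) a j) / 2))%:E *
   \int[pw]_y ((sqnorm y < 1 ?<= if b)%R%:R * prod_pow a y)%:E)%E.
Proof.
move=> v0; set A := \sum_(j < m) a j; set r := v `^ 2^-1.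
have r0 : 0 < r by exact: powR_gt0.
have r2 : r ^+ 2 = v by rewrite -powR_mulrn ?ltW// -powRrM mulVf// powRr1 ?ltW.
have mf := mball b a v.
have f0 y : (0 <= ((sqnorm y < v ?<= if b)%R%:R * prod_pow a y)%:E)%E.
  by rewrite lee_fin mulr_ge0// prod_pow_ge0.
have := ge0_integral_dil_tuple r0 mf f0.
under eq_integral => y _.
  rewrite sqnorm_dil// prod_pow_dil// -/A r2 (_ : (_ < _ ?<= if b) = (sqnorm y < 1 ?<= if b)); last first.
    by case: (b) => /=; [rewrite -[X in (_ <= X) = _]mulr1 ler_pM2l|
      rewrite -[X in (_ < X) = _]mulr1 ltr_pM2l].
  rewrite mulrCA EFinM; over.
rewrite ge0_integralZl_EFin ?powR_ge0//; last first.
  by move=> y _; rewrite lee_fin mulr_ge0// prod_pow_ge0.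
move=> h.
have -> : v `^ (A / 2) = r `^ (m%:R * Q) * r `^ (A - m%:R * Q).
  by rewrite -gt0_powRD// /r -powRrM; congr powR; field.
rewrite EFinM -muleA h muleA -EFinM -gt0_powRD// subrr powRr0 mul1e.
by [].
Qed.

Lemma integral_norm_pow_gauss a : 0 < a ->
  (\int[mu]_x (norm_pow Q N a x * expR (- N x ^+ 2))%:E =
   ball_pow mu Q N a * gammae (a / 2 + 1))%E.
Proof.
move=> a0.
apply: (@integral_expRN_layer R false).
- exact: (measurable_norm_pow hT).
- exact: norm_pow_ge0.
- exact: measurable_funX.
- by move=> x; exact: sqr_ge0.
- exact: ball_pow_ge0.
move=> v v0.
have r0 : 0 < v `^ 2^-1 by exact: powR_gt0.
rewrite /= powRrM powRAC powRAC.
have -> : ((v `^ a) `^ 2^-1 = (v `^ 2^-1) `^ a) by rewrite powRAC.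
rewrite -(integral_ball_norm_pow hT)//; apply: eq_integral => x _.
congr ((_%:R * _)%:E); congr nat_of_bool.
rewrite -[in LHS](_ : (v `^ 2^-1) ^+ 2 = v).
  by rewrite ltr_pXn2r ?nnegrE ?N0// ltW.
by rewrite -powR_mulrn ?ltW// -powRrM mulVf// powRr1 ?ltW.
Qed.

Lemma integral_sqball_gauss b a : (forall j, 0 < a j) ->
  (\int[pw]_y ((sqnorm y < 1 ?<= if b)%R%:R * prod_pow a y)%:E *
     gammae ((\sum_(j < m) a j) / 2 + 1) =
   \prod_(j < m) (ball_pow mu Q N (a j) * gammae (a j / 2 + 1)))%E.
Proof.
move=> a0.
rewrite -(@integral_expRN_layer R b _ _ pw (prod_pow a) sqnorm).
- under [RHS]eq_bigr do rewrite -integral_norm_pow_gauss//.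
  rewrite -ge0_integral_power_measure_prod.
  + apply: eq_integral => y _; congr (_%:E).
    by rewrite big_split/= -expR_sum sumrN.
  + move=> j; apply: measurable_funM; first exact: (measurable_norm_pow hT).
    apply: (measurableT_comp (@measurable_expR R)).
    apply: (measurableT_comp (@oppr_measurable R setT)).
    exact: measurable_funX.
  + by move=> j x; rewrite mulr_ge0 ?norm_pow_ge0 ?expR_ge0.
- exact: measurable_prod_pow.
- exact: prod_pow_ge0.
- exact: measurable_sqnorm.
- exact: sqnorm_ge0.
- by apply: integral_ge0 => y _; rewrite lee_fin mulr_ge0// prod_pow_ge0.
- by move=> v v0; exact: integral_sqball_prod_pow.
Qed.

Variable V : R.
Hypothesis V0 : 0 < V.
Hypothesis ballV : ball_pow mu Q N Q = V%:E.

(** Each [Q * V / a j] is the value of [ball_pow] at [a j]. The arguments of Gamma carry the [+ 1]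
    of the layer-cake formula; [hardy_constE] removes it. *)
Definition hardy_const (a : 'I_m -> R) : R :=
  (\prod_(j < m) (Q * V / a j * Gamma (a j / 2 + 1))) /
  Gamma ((\sum_(j < m) a j) / 2 + 1).

Lemma integral_sqball_prod_powE b a : (forall j, 0 < a j) ->
  (\int[pw]_y ((sqnorm y < 1 ?<= if b)%R%:R * prod_pow a y)%:E =
   (hardy_const a)%:E)%E.
Proof.
move=> a0; set I := (X in X = _).
have A0 : 0 < (\sum_(j < m) a j) / 2 + 1.
  by rewrite ltr_wpDl// divr_ge0// sumr_ge0// => j _; exact: ltW.
have := integral_sqball_gauss b a0; rewrite -/I gammae_fin// /hardy_const.
move: A0; set A := (\sum_(j < m) a j) / 2 + 1 => A0.
under eq_bigr => j _.
  rewrite (ball_powE hT)// ballV gammae_fin; last by rewrite addr_gt0// divr_gt0.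
  rewrite -!EFinM; over.
rewrite prodEFin => h.
have G0 := Gamma_gt0 A0.
have : I = (I * (Gamma A)%:E * (Gamma A)^-1%:E)%E.
  by rewrite -muleA -EFinM divff ?gt_eqF// mule1.
move=> ->; rewrite h -EFinM; congr ((_ / _)%:E).
by apply: eq_bigr => j _; congr (_ * _); ring.
Qed.

Lemma hardy_const_gt0 a : (forall j, 0 < a j) -> 0 < hardy_const a.
Proof.
move=> a0; have A0 : 0 < (\sum_(j < m) a j) / 2 + 1.
  by rewrite ltr_wpDl// divr_ge0// sumr_ge0// => j _; exact: ltW.
rewrite divr_gt0 ?Gamma_gt0// prodr_gt0// => j _.
by rewrite mulr_gt0 ?Gamma_gt0 ?addr_gt0 ?divr_gt0 ?mulr_gt0 ?(homog_dim_gt0 hT).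
Qed.

End homogeneous_power.

(** * Hoelder inequalities *)

Section hoelder_inequalities.
Context (R : realType).

Lemma prod_powR_le_sum (I : finType) (w x : I -> R) :
  (forall i, 0 < w i) -> \sum_i w i = 1 -> (forall i, 0 <= x i) ->
  \prod_i x i `^ w i <= \sum_i w i * x i.
Proof.
move=> w0 w1 x0.
have [/existsP[i xi]|] := boolP [exists i, x i == 0].
  rewrite (bigD1 i)//= (eqP xi) powR0 ?gt_eqF// mul0r.
  by apply: sumr_ge0 => j _; rewrite mulr_ge0// ltW.
rewrite negb_exists => /forallP xN0.
have {}x0 i : 0 < x i by rewrite lt_neqAle eq_sym xN0 x0.
(* [c] is the logarithm of the weighted geometric mean. After division by [expR c] the claim follows
   from [1 + t <= expR t] at [t = ln (x i) - c], since the weighted mean of these [t] is 0. *)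
pose c := \sum_i w i * ln (x i).
have -> : \prod_i x i `^ w i = expR c.
  rewrite /c expR_sum; apply: eq_bigr => i _.
  by rewrite /powR gt_eqF.
rewrite -[leLHS]mul1r -ler_pdivlMr ?expR_gt0// -expRN.
have -> : (\sum_i w i * x i) * expR (- c) = \sum_i w i * expR (ln (x i) - c).
  rewrite mulr_suml; apply: eq_bigr => i _.
  by rewrite expRD lnK ?posrE// mulrA.
have -> : 1 = \sum_i w i * (1 + (ln (x i) - c)).
  under eq_bigr do rewrite mulrDr mulr1 mulrBr.
  by rewrite big_split/= sumrB -mulr_suml w1 mul1r subrr addr0.
by apply: ler_sum => i _; apply: ler_wpM2l; [exact: ltW|exact: expR_ge1Dx].
Qed.

Context d (T : measurableType d) (mu : {measure set T -> \bar R}).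

(** Hoelder for finitely many factors: dividing each [F i] by its bound [c i] reduces it to the
    pointwise inequality of arithmetic and geometric means. *)
Lemma integral_prod_powR_le (I : finType) (w c : I -> R) (F : I -> T -> R) :
  (forall i, 0 < w i) -> \sum_i w i = 1 -> (forall i, 0 < c i) ->
  (forall i, measurable_fun [set: T] (F i)) -> (forall i x, 0 <= F i x) ->
  (forall i, \int[mu]_x (F i x)%:E <= (c i)%:E)%E ->
  (\int[mu]_x (\prod_i F i x `^ w i)%:E <= (\prod_i c i `^ w i)%:E)%E.
Proof.
move=> w0 w1 c0 mF F0 hF; set M := \prod_i c i `^ w i.
have M0 : 0 <= M by apply: prodr_ge0 => i _; exact: powR_ge0.
have mFE i : measurable_fun [set: T] (fun x => (w i / c i * F i x)%:E).
  by apply/measurable_EFinP; exact: measurable_funM.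
have wc i : 0 <= w i / c i by rewrite divr_ge0 ?ltW.
apply: (@le_trans _ _ (\int[mu]_x (M%:E * \sum_i (w i / c i * F i x)%:E))%E).
  apply: ge0_le_integral => //.
  - by move=> x _; rewrite lee_fin; apply: prodr_ge0 => i _; exact: powR_ge0.
  - apply/measurable_EFinP; apply: measurable_prod => i _.
    exact: (measurableT_comp (measurable_powR _) (mF i)).
  - by apply: measurable_funeM; exact: emeasurable_sum.
  - move=> x _; rewrite sumEFin -EFinM lee_fin.
    have -> : \prod_i F i x `^ w i = M * \prod_i (F i x / c i) `^ w i.
      rewrite -big_split/=; apply: eq_bigr => i _.
      rewrite -powRM ?(ltW (c0 i)) ?divr_ge0 ?(ltW (c0 i))//.
      by rewrite mulrC divfK// gt_eqF.
    rewrite ler_wpM2l//; apply: le_trans (prod_powR_le_sum _ _ _) _ => //.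
      by move=> i; rewrite divr_ge0// ltW.
    by rewrite le_eqVlt; apply/orP; left; apply/eqP; apply: eq_bigr => i _; ring.
rewrite ge0_integralZl_EFin//; last 2 first.
- by move=> x _; apply: sume_ge0 => i _; rewrite lee_fin mulr_ge0.
- exact: emeasurable_sum.
rewrite ge0_integral_sum//; last by move=> i x _; rewrite lee_fin mulr_ge0.
rewrite -[leRHS]mule1 lee_wpmul2l ?lee_fin//.
rewrite -w1 -sumEFin; apply: lee_sum => i _.
under eq_integral do rewrite EFinM.
rewrite ge0_integralZl_EFin//; last 2 first.
- by move=> x _; rewrite lee_fin.
- exact/measurable_EFinP.
apply: (@le_trans _ _ ((w i / c i)%:E * (c i)%:E)%E).
  by rewrite lee_wpmul2l// lee_fin.
by rewrite -EFinM divfK// gt_eqF.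
Qed.

(** Hoelder applied to [u = (h^(1-q) * u^q)^(1/q) * h^(1-1/q)]. Requiring [u] to vanish with [h]
    keeps this factorization valid at the zeros of [h], where the negative power [h^(1-q)] is 0 by
    convention. *)
Lemma poweR_integral_le (q C : R) (h u : T -> R) : 1 < q -> 0 < C ->
  measurable_fun [set: T] h -> measurable_fun [set: T] u ->
  (forall y, 0 <= h y) -> (forall y, 0 <= u y) ->
  (forall y, h y = 0 -> u y = 0) ->
  (\int[mu]_y (h y)%:E <= C%:E)%E ->
  ((\int[mu]_y (u y)%:E) `^ q <=
   (C `^ (q - 1))%:E * \int[mu]_y (h y `^ (1 - q) * u y `^ q)%:E)%E.
Proof.
move=> q1 C0 mh mu_ h0 u0 hu hC.
have q0 : 0 < q by rewrite (lt_trans ltr01).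
pose F1 y := h y `^ (1 - q) * u y `^ q.
have mF1 : measurable_fun [set: T] F1.
  apply: measurable_funM; first exact: (measurableT_comp (measurable_powR _) mh).
  exact: (measurableT_comp (measurable_powR _) mu_).
have F10 y : 0 <= F1 y by rewrite mulr_ge0 ?powR_ge0.
have J0 : (0 <= \int[mu]_y (F1 y)%:E)%E.
  by apply: integral_ge0 => y _; rewrite lee_fin.
case: (ltP (\int[mu]_y (F1 y)%:E)%E +oo%E) => [Jfin|]; last first.
  rewrite leye_eq => /eqP ->.
  by rewrite gt0_muley ?leey// lte_fin powR_gt0.
have /fineK : (\int[mu]_y (F1 y)%:E)%E \is a fin_num by rewrite ge0_fin_numE.
set J := fine _ => JE; rewrite -JE.
have {}J0 : 0 <= J by rewrite -lee_fin JE.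
apply/lee_addgt0Pr => e e0.
pose D := C `^ (q - 1); have D0 : 0 < D by exact: powR_gt0.
(* [J] may be 0 whereas [integral_prod_powR_le] wants positive bounds; the shift costs exactly [e]
   once multiplied by [D]. *)
pose J' := J + e / D.
have J'0 : 0 < J' by rewrite ltr_wpDl// divr_gt0.
pose w (b : bool) := if b then q^-1 else 1 - q^-1.
pose c (b : bool) := if b then J' else C.
pose F (b : bool) := if b then F1 else h.
have hol := @integral_prod_powR_le bool w c F.
apply: (@le_trans _ _ ((\prod_b c b `^ w b)%:E `^ q)%E).
  apply: gt0_ler_poweR => //.
  - exact: ltW.
  - rewrite in_itv/= leey andbT; apply: integral_ge0 => y _.
    by rewrite lee_fin.
  - by rewrite in_itv/= leey andbT lee_fin; apply: prodr_ge0 => b _; exact: powR_ge0.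
  have -> : (\int[mu]_y (u y)%:E = \int[mu]_y (\prod_b F b y `^ w b)%:E)%E.
    apply: eq_integral => y _; congr (_%:E).
    rewrite big_bool/= /F1.
    have := h0 y; rewrite le_eqVlt => /predU1P[hy|hy].
      by rewrite hu// powR0 ?gt_eqF// mulr0 powR0 ?mul0r// invr_eq0 gt_eqF.
    rewrite powRM ?powR_ge0// -!powRrM divff ?gt_eqF// powRr1// mulrAC -gt0_powRD//.
    have -> : (1 - q) / q + (1 - q^-1) = 0 by field; rewrite gt_eqF.
    by rewrite powRr0 mul1r.
  apply: hol.
  - by case; rewrite /= ?invr_gt0// subr_gt0 invf_lt1.
  - by rewrite big_bool/= addrC subrK.
  - by case.
  - by case.
  - by case.
  - case => //=; rewrite -JE lee_fin /J' lerDl divr_ge0// ltW//.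
rewrite poweR_EFin -EFinM -EFinD lee_fin big_bool/= powRM ?powR_ge0// -!powRrM mulVf ?gt_eqF//.
rewrite powRr1 ?(ltW J'0)// (_ : (1 - q^-1) * q = q - 1); last by field; rewrite gt_eqF.
by rewrite -/D /J' mulrDl divfK ?gt_eqF// mulrC.
Qed.

End hoelder_inequalities.

Lemma powR_prod (R : realType) (I : finType) (x : I -> R) (r : R) :
  (forall i, 0 <= x i) -> (\prod_i x i) `^ r = \prod_i x i `^ r.
Proof.
move=> x0; suff [] : (\prod_i x i) `^ r = \prod_i x i `^ r /\ 0 <= \prod_i x i.
  by [].
elim/big_rec2 : _ => [|i u v _ [<- v0]]; first by rewrite powR1.
by rewrite powRM// mulr_ge0.
Qed.

(** * Upper bound *)

Section hardy_upper_bound.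
Context d (T : measurableType d) (R : realType).
Variables (mu : {sigma_finite_measure set T -> \bar R}) (Q : R) (N : T -> R)
  (dil : R -> T -> T) (m : nat).
Hypothesis hT : homogeneous mu Q N dil.
Local Notation pw := (power_measure mu m).
Variable V : R.
Hypothesis V0 : 0 < V.
Hypothesis ballV : ball_pow mu Q N Q = V%:E.

Let mN : measurable_fun [set: T] N := homog_measurable_norm hT.
Let N0 : forall x, 0 <= N x := homog_norm_ge0 hT.

(** Integrand of the operator applied to profiles [phi j] at a point of norm [r], after dilating the
    ball of radius [r] to the unit ball. The indicators make it vanish wherever the weight [h] does,
    as [poweR_integral_le] demands. *)
Definition pos_prod (phi : 'I_m -> R -> R) (r : R) (y : m.-tuple T) : R :=
  (sqnorm N y <= 1)%R%:R *
  \prod_(j < m) ((0 < N (tnth y j))%R%:R * `|phi j (r * N (tnth y j))|).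

Lemma pos_prod_ge0 phi r y : 0 <= pos_prod phi r y.
Proof. by rewrite mulr_ge0// prodr_ge0// => j _; rewrite mulr_ge0. Qed.

Lemma measurable_pos_prod phi : (forall j, measurable_fun [set: R] (phi j)) ->
  measurable_fun [set: T * m.-tuple T] (fun p => pos_prod phi (N p.1) p.2).
Proof.
move=> mphi.
have mNj j : measurable_fun [set: T * m.-tuple T] (fun p => N (tnth p.2 j)).
  apply: (measurableT_comp mN).
  exact: (measurableT_comp (measurable_tnth j) measurable_snd).
apply: measurable_funM.
  apply: measurable_fun_boolr; apply: measurable_fun_ler => //.
  exact: (measurableT_comp (measurable_sqnorm hT) measurable_snd).
apply: measurable_prod => j _; apply: measurable_funM.
  by apply: measurable_fun_boolr; exact: measurable_fun_ltr.
apply: (measurableT_comp (@normr_measurable R setT)).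
apply: (measurableT_comp (mphi j)); apply: measurable_funM => //.
exact: (measurableT_comp mN measurable_fst).
Qed.

Lemma measurable_pos_prod_r phi r : (forall j, measurable_fun [set: R] (phi j)) ->
  measurable_fun [set: m.-tuple T] (pos_prod phi r).
Proof.
move=> mphi.
have mNj j : measurable_fun [set: m.-tuple T] (fun p => N (tnth p j)).
  exact: measurable_fun_tnth_comp.
apply: measurable_funM.
  apply: measurable_fun_boolr; apply: measurable_fun_ler => //.
  exact: (measurable_sqnorm hT).
apply: measurable_prod => j _; apply: measurable_funM.
  by apply: measurable_fun_boolr; exact: measurable_fun_ltr.
apply: (measurableT_comp (@normr_measurable R setT)).
by apply: (measurableT_comp (mphi j)); apply: measurable_funM.
Qed.

Variables (q alpha : R) (qs alphas : 'I_m -> R).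
Hypothesis m_gt0 : (0 < m)%N.
Hypothesis q_gt1 : 1 < q.
Hypothesis qs_gt1 : forall j, 1 < qs j.
Hypothesis q_sum : q^-1 = \sum_(j < m) (qs j)^-1.
Hypothesis alpha_sum : alpha = \sum_(j < m) alphas j.

Definition hexp (j : 'I_m) : R := Q - (Q / qs j + alphas j / q).
Hypothesis hexp_gt0 : forall j, 0 < hexp j.

Let q0 : 0 < q. Proof. exact: lt_trans q_gt1. Qed.
Let qs0 j : 0 < qs j. Proof. exact: lt_trans (qs_gt1 j). Qed.

Let sum_weights : \sum_(j < m) q / qs j = 1.
Proof. by rewrite -mulr_sumr -q_sum divff// gt_eqF. Qed.

Lemma norm_pow_shift b x : norm_pow Q N (Q + b) x = (0 < N x)%R%:R * N x `^ b.
Proof. by rewrite /norm_pow addrAC subrr add0r. Qed.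

Lemma integral_radial_dil (g : R -> R) b t : 0 < t ->
  measurable_fun [set: R] g -> (forall s, 0 <= g s) ->
  (\int[mu]_x (g (N x * t) * norm_pow Q N (Q + b) x)%:E =
   (t `^ (- Q - b))%:E *
   \int[mu]_x (g (N x) * norm_pow Q N (Q + b) x)%:E)%E.
Proof.
move=> t0 mg g0.
pose f x := (g (N x) * norm_pow Q N (Q + b) x)%:E.
have mf : measurable_fun [set: T] f.
  apply/measurable_EFinP; apply: measurable_funM.
    exact: (measurableT_comp mg mN).
  exact: (measurable_norm_pow hT).
have f0 x : (0 <= f x)%E by rewrite lee_fin mulr_ge0// norm_pow_ge0.
rewrite gt0_powRD// mulrC EFinM -muleA.
rewrite -(homog_integral_dil hT t0 mf f0) -ge0_integralZl_EFin ?powR_ge0//; last first.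
  by apply: (measurableT_comp mf); exact: (homog_measurable_dil hT).
apply: eq_integral => x _; rewrite /f (homog_norm_dil hT)// (norm_pow_dil hT)//.
rewrite -EFinM (mulrC t); congr (_%:E).
rewrite [RHS]mulrCA; congr (_ * _).
by rewrite mulrA -gt0_powRD// (_ : - b + _ = 0) ?powRr0 ?mul1r//; ring.
Qed.

(** Hoelder in [x] with weights [q / qs j], each factor being dilated by its own [t j]. The dilation
    yields [t j] to the power [- Q - qs j * alphas j / q]; after the weight this is
    [q * (hexp j - Q)], so with [t j = N (y_j)] the prefactor is [h y] to the power [q]. *)
Lemma hardy_upper_slice (phi : 'I_m -> R -> R) (c : 'I_m -> R)
    (t : 'I_m -> R) :
  (forall j, measurable_fun [set: R] (phi j)) -> (forall j, 0 < c j) ->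
  (forall j, 0 < t j) ->
  (forall j, \int[mu]_x (`|phi j (N x)| `^ qs j *
     norm_pow Q N (Q + qs j * alphas j / q) x)%:E = (c j)%:E)%E ->
  (\int[mu]_x (norm_pow Q N (Q + alpha) x *
      (\prod_(j < m) `|phi j (N x * t j)|) `^ q)%:E <=
   ((\prod_(j < m) t j `^ (hexp j - Q)) `^ q *
    \prod_(j < m) c j `^ (q / qs j))%:E)%E.
Proof.
move=> mphi c0 t0 hc.
pose w j := q / qs j.
pose c' j := t j `^ (- Q - qs j * alphas j / q) * c j.
pose F j x := `|phi j (N x * t j)| `^ qs j *
     norm_pow Q N (Q + qs j * alphas j / q) x.
have F0 j x : 0 <= F j x by rewrite mulr_ge0 ?powR_ge0 ?norm_pow_ge0.
have mF j : measurable_fun [set: T] (F j).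
  apply: measurable_funM; last exact: (measurable_norm_pow hT).
  apply: (measurableT_comp (measurable_powR _)).
  apply: (measurableT_comp (@normr_measurable R setT)).
  by apply: (measurableT_comp (mphi j)); apply: measurable_funM.
have hF j : (\int[mu]_x (F j x)%:E <= (c' j)%:E)%E.
  rewrite /F (@integral_radial_dil (fun s => `|phi j s| `^ qs j))//.
  - by rewrite hc -EFinM.
  - apply: (measurableT_comp (measurable_powR _)).
    exact: (measurableT_comp (@normr_measurable R setT)).
have w0 j : 0 < w j by rewrite divr_gt0.
have c'0 j : 0 < c' j by rewrite mulr_gt0// powR_gt0.
have := integral_prod_powR_le w0 sum_weights c'0 mF F0 hF.
have -> : \prod_i c' i `^ w i =
    (\prod_(j < m) t j `^ (hexp j - Q)) `^ q * \prod_(j < m) c j `^ (q / qs j).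
  rewrite powR_prod; last by move=> j; exact: powR_ge0.
  rewrite -big_split/=; apply: eq_bigr => j _.
  rewrite (powRM _ (powR_ge0 _ _) (ltW (c0 j))) -!powRrM; congr (powR _ _ * _).
  by rewrite /w /hexp; field; rewrite !gt_eqF.
move=> H; apply: le_trans H; rewrite le_eqVlt; apply/orP; left; apply/eqP.
apply: eq_integral => x _; congr (_%:E).
rewrite norm_pow_shift /F.
have [Nx|Nx] := ltP 0 (N x); last first.
  rewrite !mul0r; apply/esym/eqP/prodf_eq0.
  (* At points of norm 0 the weight kills the left side; a factor must exist for the product on the
     right to vanish as well. *)
  exists (Ordinal m_gt0) => //; rewrite /norm_pow ltNge Nx /=.
  by rewrite mul0r mulr0 powR0// gt_eqF.
rewrite mul1r powR_prod//.
have -> : N x `^ alpha = \prod_(j < m) N x `^ alphas j.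
  rewrite alpha_sum; elim/big_rec2 : _ => [|j u v _ <-]; first by rewrite powRr0.
  by rewrite -gt0_powRD.
rewrite -big_split/=; apply: eq_bigr => j _.
rewrite norm_pow_shift Nx mul1r powRM ?powR_ge0// -!powRrM /w mulrC.
by congr (powR _ _ * powR _ _); field; rewrite !gt_eqF.
Qed.

(** Origin of the power of [K]: Hoelder in [y] costs [K^(q-1)]; after Tonelli the slice bound turns
    [h^(1-q)] times the [x]-integral into at most [h * M], and integrating [h] supplies the last
    factor [K]. *)
Lemma hardy_upper (phi : 'I_m -> R -> R) (c : 'I_m -> R) :
  (forall j, measurable_fun [set: R] (phi j)) -> (forall j, 0 < c j) ->
  (forall j, \int[mu]_x (`|phi j (N x)| `^ qs j *
     norm_pow Q N (Q + qs j * alphas j / q) x)%:E = (c j)%:E)%E ->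
  (\int[mu]_x ((\int[pw]_y (pos_prod phi (N x) y)%:E) `^ q *
      (norm_pow Q N (Q + alpha) x)%:E) <=
   (hardy_const Q V hexp `^ q * \prod_(j < m) c j `^ (q / qs j))%:E)%E.
Proof.
move=> mphi c0 hc.
set K := hardy_const Q V hexp; set M := \prod_(j < m) _.
have K0 : 0 < K := hardy_const_gt0 hT V0 hexp_gt0.
have M0 : 0 <= M by apply: prodr_ge0 => j _; exact: powR_ge0.
pose h y := (sqnorm N y <= 1)%R%:R * prod_pow Q N hexp y.
have h0 y : 0 <= h y by rewrite mulr_ge0// prod_pow_ge0.
have mh : measurable_fun [set: m.-tuple T] h.
  apply: measurable_funM; last exact: (measurable_prod_pow hT).
  apply: measurable_fun_boolr; apply: measurable_fun_ler => //.
  exact: (measurable_sqnorm hT).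
have hK : (\int[pw]_y (h y)%:E = K%:E)%E.
  by have /= := integral_sqball_prod_powE hT ballV true hexp_gt0.
have hpos y : h y != 0 -> [/\ sqnorm N y <= 1, forall j, 0 < N (tnth y j) &
    h y = \prod_(j < m) N (tnth y j) `^ (hexp j - Q)].
  rewrite /h; case: (sqnorm N y <= 1); last by rewrite mul0r eqxx.
  rewrite mul1r => /prodf_neq0 hy.
  have Nj j : 0 < N (tnth y j).
    have := hy j isT; rewrite /norm_pow.
    by case: (0 < N (tnth y j)) => //; rewrite mul0r eqxx.
  split=> //; apply: eq_bigr => j _.
  by rewrite /norm_pow Nj mul1r.
have hu r y : h y = 0 -> pos_prod phi r y = 0.
  rewrite /h /pos_prod; case: (sqnorm N y <= 1); last by rewrite !mul0r.
  rewrite !mul1r => /eqP/prodf_eq0[j _ /eqP hj].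
  apply/eqP/prodf_eq0; exists j => //.
  case: (ltP 0 (N (tnth y j))) => [Nj|]; last by rewrite mul0r.
  by move: hj; rewrite /norm_pow Nj mul1r => /powR_eq0_eq0 Nj0; rewrite Nj0 ltxx in Nj.
pose W := norm_pow Q N (Q + alpha).
have W0 x : 0 <= W x by exact: norm_pow_ge0.
have mW : measurable_fun [set: T] W by exact: (measurable_norm_pow hT).
pose k (p : T * m.-tuple T) :=
  W p.1 * (h p.2 `^ (1 - q) * pos_prod phi (N p.1) p.2 `^ q).
have k0 p : 0 <= k p by rewrite mulr_ge0// mulr_ge0 ?powR_ge0.
have mk : measurable_fun [set: T * m.-tuple T] k.
  apply: measurable_funM; first exact: (measurableT_comp mW measurable_fst).
  apply: measurable_funM.
    apply: (measurableT_comp (measurable_powR _)).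
    exact: (measurableT_comp mh measurable_snd).
  exact: (measurableT_comp (measurable_powR _) (measurable_pos_prod mphi)).
have mkE : measurable_fun [set: T * m.-tuple T] (EFin \o k) by exact/measurable_EFinP.
have k0E p : (0 <= (EFin \o k) p)%E by rewrite lee_fin.
set D := K `^ (q - 1); have D0 : 0 <= D by exact: powR_ge0.
have mG : measurable_fun [set: T] (fun x => \int[pw]_y (pos_prod phi (N x) y)%:E)%E.
  pose g (p : T * m.-tuple T) := (pos_prod phi (N p.1) p.2)%:E.
  apply: (@measurable_fun_fubini_tonelli_F _ _ T (m.-tuple T) R pw g).
    by apply/measurable_EFinP; exact: measurable_pos_prod.
  by move=> p; rewrite lee_fin pos_prod_ge0.
apply: (@le_trans _ _ (\int[mu]_x (D%:E * \int[pw]_y (k (x, y))%:E))%E).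
  apply: ge0_le_integral => //.
  - by move=> x _; rewrite mule_ge0 ?poweR_ge0 ?lee_fin.
  - apply: emeasurable_funM; last exact/measurable_EFinP.
    exact: (measurableT_comp (measurable_poweR _) mG).
  - apply: measurable_funeM.
    exact: (@measurable_fun_fubini_tonelli_F _ _ T (m.-tuple T) R pw _ mkE k0E).
  - move=> x _.
    have ineq := @poweR_integral_le R _ _ pw q K h (pos_prod phi (N x)) q_gt1 K0 mh
      (measurable_pos_prod_r (N x) mphi) h0 (pos_prod_ge0 phi (N x)) (hu (N x)) _.
    apply: (@le_trans _ _ ((D%:E * \int[pw]_y (h y `^ (1 - q) * pos_prod phi (N x) y `^ q)%:E) * (W x)%:E)%E).
      by apply: lee_wpmul2r; [rewrite lee_fin|apply: ineq; rewrite hK].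
    rewrite -muleA muleC -(muleC D%:E) -ge0_integralZr; last 4 first.
    + by [].
    + apply/measurable_EFinP; apply: measurable_funM.
        exact: (measurableT_comp (measurable_powR _) mh).
      apply: (measurableT_comp (measurable_powR _)).
      exact: measurable_pos_prod_r.
    + by move=> y _; rewrite lee_fin mulr_ge0 ?powR_ge0.
    + by rewrite lee_fin.
    rewrite le_eqVlt; apply/orP; left; apply/eqP; congr (_ * _)%E.
    by apply: eq_integral => y _; rewrite -EFinM mulrC.
rewrite ge0_integralZl_EFin//; last 2 first.
- by move=> x _; apply: integral_ge0 => y _; rewrite lee_fin.
- exact: (@measurable_fun_fubini_tonelli_F _ _ T (m.-tuple T) R pw _ mkE k0E).
rewrite (@fubini_tonelli _ _ T (m.-tuple T) R mu pw _ mkE k0E).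
apply: (@le_trans _ _ (D%:E * \int[pw]_y (M%:E * (h y)%:E))%E).
  apply: lee_wpmul2l; first by rewrite lee_fin.
  apply: ge0_le_integral => //.
  - by move=> y _; apply: integral_ge0 => x _; rewrite lee_fin.
  - exact: (@measurable_fun_fubini_tonelli_G _ _ T (m.-tuple T) R mu _ mkE k0E).
  - by apply: measurable_funeM; exact/measurable_EFinP.
  - move=> y _ /=; rewrite /k /=.
    have [hy|hy] := eqVneq (h y) 0.
      rewrite integral0_eq ?hy ?mule0// => x _.
      by rewrite hu// powR0 ?mulr0// gt_eqF.
    have [sq1 Nj hyE] := hpos y hy.
    have hyp : 0 < h y by rewrite lt_neqAle eq_sym hy h0.
    have := hardy_upper_slice mphi c0 Nj hc; rewrite -hyE -/M => slice.
    apply: (@le_trans _ _ ((h y `^ (1 - q))%:E * (h y `^ q * M)%:E)%E); last first.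
      rewrite -!EFinM lee_fin mulrA -gt0_powRD// subrK powRr1// mulrC//.
    apply: (@le_trans _ _ ((h y `^ (1 - q))%:E * \int[mu]_x (W x *
      (\prod_(j < m) `|phi j (N x * N (tnth y j))|) `^ q)%:E)%E); last first.
      by apply: lee_wpmul2l; rewrite ?lee_fin ?powR_ge0.
    rewrite -ge0_integralZl_EFin ?powR_ge0//; last 2 first.
    + by move=> x _; rewrite lee_fin mulr_ge0 ?powR_ge0.
    + apply/measurable_EFinP; apply: measurable_funM => //.
      apply: (measurableT_comp (measurable_powR _)).
      apply: measurable_prod => j _.
      apply: (measurableT_comp (@normr_measurable R setT)).
      by apply: (measurableT_comp (mphi j)); apply: measurable_funM.
    rewrite le_eqVlt; apply/orP; left; apply/eqP.
    apply: eq_integral => x _; rewrite -EFinM; congr (_%:E).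
    rewrite mulrCA; congr (_ * (_ * powR _ _)).
    rewrite /pos_prod sq1 mul1r; apply: eq_bigr => j _.
    by rewrite Nj mul1r.
rewrite ge0_integralZl_EFin//; last 2 first.
- by move=> y _; rewrite lee_fin.
- exact/measurable_EFinP.
rewrite hK -!EFinM lee_fin mulrCA /D -{2}(powRr1 (ltW K0)) -gt0_powRD// subrK.
by rewrite mulrC.
Qed.

End hardy_upper_bound.

(** * Lower bound *)

Section hardy_lower_bound.
Context d (T : measurableType d) (R : realType).
Variables (mu : {sigma_finite_measure set T -> \bar R}) (Q : R) (N : T -> R)
  (dil : R -> T -> T) (m : nat).
Hypothesis hT : homogeneous mu Q N dil.
Local Notation pw := (power_measure mu m).
Variable V : R.
Hypothesis V0 : 0 < V.
Hypothesis ballV : ball_pow mu Q N Q = V%:E.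
Variables (q alpha : R) (qs alphas : 'I_m -> R).
Hypothesis q_gt1 : 1 < q.
Hypothesis qs_gt1 : forall j, 1 < qs j.
Hypothesis q_sum : q^-1 = \sum_(j < m) (qs j)^-1.
Hypothesis alpha_sum : alpha = \sum_(j < m) alphas j.
Local Notation a := (hexp Q q qs alphas).
Hypothesis a_gt0 : forall j, 0 < a j.

Let mN : measurable_fun [set: T] N := homog_measurable_norm hT.
Let N0 : forall x, 0 <= N x := homog_norm_ge0 hT.
Let q0 : 0 < q. Proof. exact: lt_trans q_gt1. Qed.
Let qs0 j : 0 < qs j. Proof. exact: lt_trans (qs_gt1 j). Qed.

(** The share [q / qs j] of [eps] is chosen so that the integrand of the weighted [qs j]-norm is the
    power [eps * q - Q] for every [j]; since the shares add up to 1, the product of the profiles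
    gains exactly [eps]. *)
Definition extremal (eps : R) (j : 'I_m) (s : R) : R :=
  (0 < s < 1)%R%:R * s `^ (a j - Q + eps * (q / qs j)).

Lemma measurable_extremal eps j : measurable_fun [set: R] (extremal eps j).
Proof.
apply: measurable_funM; last exact: measurable_powR.
by apply: measurable_fun_boolr; apply: measurable_and; exact: measurable_fun_ltr.
Qed.

Lemma extremal_ge0 eps j s : 0 <= extremal eps j s.
Proof. by rewrite mulr_ge0// powR_ge0. Qed.

Lemma integral_extremal eps j : 0 < eps ->
  (\int[mu]_x (`|extremal eps j (N x)| `^ qs j *
     norm_pow Q N (Q + qs j * alphas j / q) x)%:E =
   (Q * V / (eps * q))%:E)%E.
Proof.
move=> e0; have eq0 : 0 < eps * q by rewrite mulr_gt0.
transitivity (ball_pow mu Q N (eps * q)); last first.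
  by rewrite (ball_powE hT)// ballV -EFinM; congr (_%:E); ring.
apply: eq_integral => x _; congr (_%:E).
rewrite ger0_norm ?extremal_ge0// /extremal /norm_pow.
have [Nx|Nx] := ltP 0 (N x); last by rewrite !mul0r !mulr0.
case: (ltP (N x) 1) => N1 /=; last by rewrite !mul0r powR0 ?mul0r// gt_eqF.
rewrite !mul1r -powRrM -gt0_powRD//; congr powR; rewrite /hexp; field.
by rewrite !gt_eqF.
Qed.

Let sum_weights : \sum_(j < m) q / qs j = 1.
Proof. by rewrite -mulr_sumr -q_sum divff// gt_eqF. Qed.

Let sum_exp : \sum_(j < m) (a j - Q) = - (Q / q) - alpha / q.
Proof.
rewrite /hexp (eq_bigr (fun j => - (Q * (qs j)^-1) + - (alphas j * q^-1))).
  by rewrite big_split/= !sumrN -mulr_sumr -mulr_suml -q_sum -alpha_sum.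
by move=> j _; ring.
Qed.

Lemma integral_pos_prod_extremal eps x : 0 < eps -> 0 < N x < 1 ->
  (\int[pw]_y (pos_prod N (extremal eps) (N x) y)%:E =
   (N x `^ (- (Q / q) - alpha / q + eps) *
    hardy_const Q V (fun j => a j + eps * (q / qs j)))%:E)%E.
Proof.
move=> e0 /andP[Nx Nx1].
have b0 j : 0 < a j + eps * (q / qs j) by rewrite addr_gt0// mulr_gt0// divr_gt0.
rewrite EFinM -(integral_sqball_prod_powE hT ballV true b0) -ge0_integralZl_EFin ?powR_ge0//; last 2 first.
- by move=> y _; rewrite lee_fin mulr_ge0// prod_pow_ge0.
- apply/measurable_EFinP; apply: measurable_funM; last exact: (measurable_prod_pow hT).
  apply: measurable_fun_boolr; apply: measurable_fun_ler => //.
  exact: (measurable_sqnorm hT).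
apply: eq_integral => y _; rewrite -EFinM; congr (_%:E).
rewrite /pos_prod /=; case: (boolP (sqnorm N y <= 1)) => [sq1|_]; last by rewrite !mul0r mulr0.
rewrite !mul1r.
(* Together with [N x < 1] this puts [N x * N (tnth y j)] below 1, so the cutoff in [extremal] is
   invisible. *)
have Nj j : N (tnth y j) <= 1.
  rewrite -(@ler_pXn2r _ 2)// ?nnegrE// expr1n; apply: le_trans sq1.
  rewrite /sqnorm (bigD1 j)//= lerDl; apply: sumr_ge0 => i _; exact: sqr_ge0.
have -> : N x `^ (- (Q / q) - alpha / q + eps) =
    \prod_(j < m) N x `^ (a j - Q + eps * (q / qs j)).
  rewrite -sum_exp -[X in _ + X]mulr1 -sum_weights mulr_sumr -big_split/=.
  elim/big_rec2 : _ => [|j u v _ <-]; first by rewrite powRr0.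
  by rewrite -gt0_powRD.
rewrite -big_split/=; apply: eq_bigr => j _.
rewrite ger0_norm ?extremal_ge0// /extremal /norm_pow.
have [Nyj|] := ltP 0 (N (tnth y j)); last by rewrite !mul0r mulr0.
rewrite !mul1r mulr_gt0//= (le_lt_trans _ Nx1)/=; last by rewrite ger_pMr.
by rewrite mul1r powRM ?ltW//; congr (_ * powR _ _); ring.
Qed.

(** Only the part over [N x < 1] is computed and the rest is dropped. There the [q]-th power of the
    operator times the weight is [K^q] times the power [eps * q - Q], the same power as in
    [integral_extremal]. *)
Lemma hardy_lower eps : 0 < eps ->
  ((hardy_const Q V (fun j => a j + eps * (q / qs j)) `^ q * (Q * V / (eps * q)))%:E <=
  \int[mu]_x ((\int[pw]_y (pos_prod N (extremal eps) (N x) y)%:E) `^ q *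
      (norm_pow Q N (Q + alpha) x)%:E))%E.
Proof.
move=> e0; set K := hardy_const _ _ _.
have eq0 : 0 < eps * q by rewrite mulr_gt0.
have b0 j : 0 < a j + eps * (q / qs j) by rewrite addr_gt0// mulr_gt0// divr_gt0.
have K0 : 0 < K := hardy_const_gt0 hT V0 b0.
have mphi := measurable_extremal eps.
have mG : measurable_fun [set: T]
    (fun x => \int[pw]_y (pos_prod N (extremal eps) (N x) y)%:E)%E.
  pose g (p : T * m.-tuple T) := (pos_prod N (extremal eps) (N p.1) p.2)%:E.
  apply: (@measurable_fun_fubini_tonelli_F _ _ T (m.-tuple T) R pw g).
    by apply/measurable_EFinP; exact: (measurable_pos_prod hT).
  by move=> p; rewrite lee_fin pos_prod_ge0.
have mb c : measurable_fun [set: T]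
    (fun x => ((N x < 1)%R%:R * norm_pow Q N c x)%:E).
  apply/measurable_EFinP; apply: measurable_funM; last exact: (measurable_norm_pow hT).
  by apply: measurable_fun_boolr; exact: measurable_fun_ltr.
have -> : ((K `^ q * (Q * V / (eps * q)))%:E =
    \int[mu]_x ((K `^ q)%:E * ((N x < 1)%R%:R * norm_pow Q N (eps * q) x)%:E))%E.
  rewrite ge0_integralZl_EFin ?powR_ge0//.
  - rewrite -/(ball_pow mu Q N (eps * q)) (ball_powE hT)// ballV -!EFinM.
    by congr (_%:E); ring.
  - by move=> x _; rewrite lee_fin mulr_ge0// norm_pow_ge0.
apply: ge0_le_integral => //.
- by move=> x _; rewrite mule_ge0 ?lee_fin ?powR_ge0// mulr_ge0// norm_pow_ge0.
- exact: measurable_funeM.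
- apply: emeasurable_funM; first exact: (measurableT_comp (measurable_poweR _) mG).
  by apply/measurable_EFinP; exact: (measurable_norm_pow hT).
move=> x _.
have [/andP[Nx N1]|] := boolP (0 < N x < 1); last first.
  rewrite negb_and => h.
  have -> : (N x < 1)%R%:R * norm_pow Q N (eps * q) x = 0.
    by case/orP: h => /negbTE h; rewrite /norm_pow h mul0r ?mulr0.
  by rewrite mule0 mule_ge0 ?poweR_ge0// lee_fin norm_pow_ge0.
rewrite integral_pos_prod_extremal ?Nx// -/K.
rewrite poweR_EFin -!EFinM lee_fin N1 mul1r /norm_pow Nx !mul1r.
rewrite powRM ?powR_ge0 ?(ltW K0)// -powRrM mulrAC -gt0_powRD// mulrC.
rewrite le_eqVlt; apply/orP; left; apply/eqP; congr (powR _ _ * _).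
by field; rewrite gt_eqF.
Qed.

(** The limit is taken in the integral form of [hardy_const], by monotone convergence along
    [eps = 1 / (k + 1)], so no continuity of Gamma is invoked. *)
Lemma hardy_const_cvg (S : \bar R) :
  (forall eps, 0 < eps ->
    ((hardy_const Q V (fun j => a j + eps * (q / qs j)))%:E <= S)%E) ->
  ((hardy_const Q V a)%:E <= S)%E.
Proof.
move=> hS.
pose e k : R := k.+1%:R^-1.
pose b k j := a j + e k * (q / qs j).
have e0 k : 0 < e k by rewrite invr_gt0.
have b0 k j : 0 < b k j by rewrite addr_gt0// mulr_gt0// divr_gt0.
pose h (c : 'I_m -> R) (y : m.-tuple T) := (sqnorm N y <= 1)%R%:R * prod_pow Q N c y.
have hE c (c0 : forall j, 0 < c j) : (\int[pw]_y (h c y)%:E = (hardy_const Q V c)%:E)%E.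
  by have /= := integral_sqball_prod_powE hT ballV true c0.
have mh c : measurable_fun [set: m.-tuple T] (fun y => (h c y)%:E).
  apply/measurable_EFinP; apply: measurable_funM; last exact: (measurable_prod_pow hT).
  apply: measurable_fun_boolr; apply: measurable_fun_ler => //.
  exact: (measurable_sqnorm hT).
have h0 c y : 0 <= h c y by rewrite mulr_ge0// prod_pow_ge0.
(* The perturbation multiplies the integrand by [expR (e k * s y)]. On the unit ball all norms are
   at most 1, so [s y <= 0] and the factor increases to 1 as [e k] decreases to 0. *)
pose s (y : m.-tuple T) := \sum_(j < m) (q / qs j) * ln (N (tnth y j)).
have hb k y : h (b k) y = h a y * expR (e k * s y).
  rewrite /h -mulrA /s; congr (_ * _).
  rewrite mulr_sumr expR_sum /prod_pow -big_split/=; apply: eq_bigr => j _.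
  rewrite /norm_pow /b; have [Nj|] := ltP 0 (N (tnth y j)); last by rewrite !mul0r.
  rewrite !mul1r addrAC [LHS]gt0_powRD//; congr (_ * _).
  by rewrite /powR (gt_eqF Nj); congr expR; ring.
have s0 y : h a y != 0 -> s y <= 0.
  rewrite /h; case: (boolP (sqnorm N y <= 1)) => [sq1|_]; last by rewrite mul0r eqxx.
  move=> _; apply: sumr_le0 => j _; apply: mulr_ge0_le0.
    by rewrite divr_ge0 ?(ltW q0) ?(ltW (qs0 j)).
  apply: ln_le0.
  rewrite -(@ler_pXn2r _ 2)// ?nnegrE// expr1n; apply: le_trans sq1.
  rewrite /sqnorm (bigD1 j)//= lerDl; apply: sumr_ge0 => i _; exact: sqr_ge0.
have hlim y : limn (fun k => (h (b k) y)%:E) = (h a y)%:E.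
  apply/cvg_lim => //; apply: cvg_EFin; first by near=> k.
  rewrite /comp /=; under eq_fun do rewrite hb.
  have c1 : (fun k => e k * s y) @ \oo --> (0 * s y : R).
    by apply: cvgM; [exact: cvg_harmonic|exact: cvg_cst].
  have c2 : (fun k => expR (e k * s y)) @ \oo --> (expR (0 * s y) : R).
    exact: (cvg_comp _ _ c1 (@continuous_expR R _)).
  have : (fun k => h a y * expR (e k * s y)) @ \oo --> (h a y * expR (0 * s y) : R).
    by apply: cvgM => //; exact: cvg_cst.
  by rewrite mul0r expR0 mulr1.
have hmono y : {homo (fun k => (h (b k) y)%:E) : k l / (k <= l)%N >-> (k <= l)%E}.
  move=> k l kl; rewrite lee_fin !hb.
  have [->|hy] := eqVneq (h a y) 0; first by rewrite !mul0r.
  rewrite ler_wpM2l// ler_expR ler_wnM2r ?s0//.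
  by rewrite lef_pV2 ?posrE// ler_nat.
have hcv : (\int[pw]_y (h (b k) y)%:E @[k --> \oo] --> \int[pw]_y (h a y)%:E)%E.
  rewrite -(eq_integral _ _ (fun y _ => hlim y)).
  apply: (@cvg_monotone_convergence _ _ _ pw setT measurableT
    (fun k y => (h (b k) y)%:E) (fun k => mh (b k))) => [k y _|y _].
    by rewrite lee_fin.
  exact: hmono.
rewrite -hE// -(cvg_lim _ hcv)//; apply: lime_le.
  by apply/cvg_ex; exists (\int[pw]_y (h a y)%:E)%E.
by apply: nearW => k; rewrite hE//; exact: hS.
Unshelve. all: by end_near. Qed.

End hardy_lower_bound.

(** * From the ball of radius [r] to the unit ball *)

Section radial_ball_integral.
Context d (T : measurableType d) (R : realType).
Variables (mu : {sigma_finite_measure set T -> \bar R}) (Q : R) (N : T -> R)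
  (dil : R -> T -> T) (m : nat).
Hypothesis hT : homogeneous mu Q N dil.
Local Notation pw := (power_measure mu m).
Hypothesis null0 : mu [set x | N x = 0] = 0%E.

Let mN : measurable_fun [set: T] N := homog_measurable_norm hT.
Let N0 : forall x, 0 <= N x := homog_norm_ge0 hT.

Lemma ae_norm_gt0 : \forall x \ae mu, 0 < N x.
Proof.
exists [set x | N x = 0]; split => //.
- by rewrite -[X in measurable X]setTI; exact: (mN measurableT (measurable_set1 0)).
- move=> x /= /negP; rewrite lt_neqAle N0 andbT negbK => /eqP <-.
  by [].
Qed.

Lemma ae_power_norm_gt0 : \forall y \ae pw, forall j, 0 < N (tnth y j).
Proof.
apply: filter_forall => j.
have mZ : measurable [set x | N x = 0].
  by rewrite -[X in measurable X]setTI; exact: (mN measurableT (measurable_set1 0)).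
exists [set y | [set x | N x = 0] (tnth y j)]; split.
- rewrite -[X in measurable X]setTI.
  exact: (measurable_tnth j measurableT mZ).
- exact: power_measure_tnth_null.
- move=> y /= /negP; rewrite lt_neqAle N0 andbT negbK => /eqP <-.
  by [].
Qed.

(** The normalising factor of the operator is exactly the Jacobian of the dilation by [r]. The
    indicators in [pos_prod] are then inserted almost everywhere, because a tuple with a coordinate
    of norm 0 lies in a null set. *)
Lemma integral_radial_ball (phi : 'I_m -> R -> R) r : 0 < r ->
  (forall j, measurable_fun [set: R] (phi j)) ->
  ((r `^ (- (m%:R * Q)))%:E *
   \int[pw]_y ((sqnorm N y <= r ^+ 2)%R%:R *
      \prod_(j < m) `|phi j (N (tnth y j))|)%:E =
   \int[pw]_y (pos_prod N phi r y)%:E)%E.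
Proof.
move=> r0 mphi.
have mg : measurable_fun [set: m.-tuple T]
    (fun y => ((sqnorm N y <= r ^+ 2)%R%:R *
      \prod_(j < m) `|phi j (N (tnth y j))|)%:E).
  apply/measurable_EFinP; apply: measurable_funM.
    apply: measurable_fun_boolr; apply: measurable_fun_ler => //.
    exact: (measurable_sqnorm hT).
  apply: measurable_prod => j _.
  apply: (measurableT_comp (@normr_measurable R setT)).
  by apply: (measurableT_comp (mphi j)); exact: measurable_fun_tnth_comp.
rewrite -(ge0_integral_dil_tuple hT r0 mg); last first.
  by move=> y; rewrite lee_fin mulr_ge0// prodr_ge0.
have md : measurable_fun [set: m.-tuple T] (@dil_tuple _ T R dil m r).
  by apply: measurable_tuple_map_nth => _; exact: (homog_measurable_dil hT).
apply: ge0_ae_eq_integral => //.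
- exact: (measurableT_comp mg md).
- by apply/measurable_EFinP; exact: (measurable_pos_prod_r hT).
- by move=> y _; rewrite lee_fin mulr_ge0// prodr_ge0.
- by move=> y _; rewrite lee_fin pos_prod_ge0.
apply: filterS ae_power_norm_gt0 => y Ny _; congr (_%:E).
rewrite /pos_prod (sqnorm_dil hT)// -[X in _ <= X]mulr1 ler_pM2l ?exprn_gt0//.
congr (_ * _); apply: eq_bigr => j _.
by rewrite Ny mul1r tnth_tuple_map_nth (homog_norm_dil hT).
Qed.

End radial_ball_integral.

(** * The Heisenberg group as a homogeneous space *)

Section heisenberg_homogeneous.
Context (R : realType) (n : nat).
Local Notation H := (heisenberg R n).
Local Notation mu := (heisenberg_measure R n).
Local Notation leb := (@lebesgue_measure R).
Local Notation Q := ((hdim n)%:R : R).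
Local Notation hN := (@hnorm R n).

Definition hdil_coord (r : R) (i : 'I_(2 * n).+1) (t : R) : R :=
  (if i == ord_max then r ^+ 2 else r) * t.

Definition hdil (r : R) (x : H) : H :=
  tuple_map_nth (hdil_coord r : 'I__ -> measurableTypeR R -> measurableTypeR R) x.

Lemma hcoord_dil r x i : hcoord (hdil r x) i = hdil_coord r i (hcoord x i).
Proof. by rewrite /hcoord tnth_tuple_map_nth. Qed.

Lemma measurable_hcoord i : measurable_fun [set: H] (fun x : H => hcoord x i).
Proof. exact: measurable_tnth. Qed.

Lemma measurable_hnorm : measurable_fun [set: H] hN.
Proof.
apply: (measurableT_comp (measurable_powR _)).
apply: measurable_funD; apply: measurable_funX; last exact: measurable_hcoord.
apply: measurable_sum => i; apply: measurable_funX; exact: measurable_hcoord.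
Qed.

Lemma hnorm_ge0 (x : H) : 0 <= hnorm x.
Proof. exact: powR_ge0. Qed.

Lemma hnormX4 (x : H) : hnorm x ^+ 4 =
  (\sum_(i < 2 * n) hcoord x (widen_ord (leqnSn (2 * n)) i) ^+ 2) ^+ 2
    + hcoord x ord_max ^+ 2.
Proof.
rewrite /hnorm -powR_mulrn ?powR_ge0// -powRrM mulVf// powRr1//.
by rewrite addr_ge0// sqr_ge0.
Qed.

Lemma hnorm_dil r (x : H) : 0 < r -> hnorm (hdil r x) = r * hnorm x.
Proof.
move=> r0; apply/eqP; rewrite -(@eqrXn2 _ 4) ?hnorm_ge0 ?mulr_ge0 ?hnorm_ge0 ?(ltW r0)//.
apply/eqP; rewrite exprMn !hnormX4.
under eq_bigr => i _.
  rewrite hcoord_dil /hdil_coord -val_eqE/= ltn_eqF// exprMn; over.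
rewrite -mulr_sumr hcoord_dil /hdil_coord eqxx; ring.
Qed.

Lemma homogeneous_heisenberg : homogeneous mu Q hN hdil.
Proof.
split.
- by rewrite ltr0n /hdim addn2.
- exact: measurable_hnorm.
- exact: hnorm_ge0.
- exact: hnorm_dil.
- move=> r r0; apply: measurable_tuple_map_nth => i; exact: mulrl_measurable.
- move=> r f r0 mf f0.
  (* One-dimensional Jacobians: [2 n] factors [1 / r] and one factor [1 / r^2] make up the power
     [- (2 n + 2)]. *)
  pose c (i : 'I_(2 * n).+1) := (if i == ord_max then r ^+ 2 else r)^-1.
  have c0 i : 0 < (if i == ord_max :> 'I_(2 * n).+1 then r ^+ 2 else r).
    by case: ifP => // _; exact: exprn_gt0.
  rewrite (ge0_integral_power_measure_map (c := c))//.
  + congr (_%:E * _)%E; rewrite big_ord_recr/= /c eqxx.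
    under eq_bigr do rewrite -val_eqE/= ltn_eqF//.
    rewrite prodr_const card_ord powRN powR_mulrn ?ltW// -exprVn.
    by rewrite -exprVn -exprD.
  + by move=> i; exact: mulrl_measurable.
  + by move=> i; rewrite invr_ge0 ltW.
  + by move=> i g mg g0; rewrite integral_lebesgue_scale.
Qed.

(** Norm 0 forces the last coordinate to be 0, which confines the point to a null hyperplane. *)
Lemma hnorm_eq0_null : mu [set x | hnorm x = 0] = 0%E.
Proof.
have mZ : measurable [set x : H | hnorm x = 0].
  by rewrite -[X in measurable X]setTI; exact: (measurable_hnorm measurableT (measurable_set1 0)).
apply: (@subset_measure0 _ _ _ mu _ [set x | [set 0 : measurableTypeR R] (tnth x ord_max)]).
- exact: mZ.
- rewrite -[X in measurable X]setTI.
  exact: (measurable_tnth _ measurableT (measurable_set1 0)).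
- move=> x /= x0; have := hnormX4 x; rewrite x0 expr0n/= => /esym/eqP.
  rewrite paddr_eq0 ?sqr_ge0// => /andP[_]; rewrite sqrf_eq0 => /eqP; exact.
- by apply: power_measure_tnth_null => //; exact: lebesgue_measure_set1.
Qed.

Lemma hball_subset_box (x : H) i : hnorm x < 1 -> `|hcoord x i| < 1.
Proof.
move=> x1.
have h4 : hnorm x ^+ 4 < 1 by rewrite exprn_ilt1// hnorm_ge0.
rewrite hnormX4 in h4.
case: (unliftP ord_max i) => [j|] ->; last first.
  rewrite -(@ltr_pXn2r _ 2)// ?nnegrE// expr1n real_normK ?num_real//.
  by apply: le_lt_trans h4; rewrite lerDr sqr_ge0.
have -> : lift ord_max j = widen_ord (leqnSn (2 * n)) j.
  by apply/val_inj; rewrite /= /bump leqNgt ltn_ord.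
set s := \sum_(i < 2 * n) _ in h4.
have s0 : 0 <= s by apply: sumr_ge0 => k _; exact: sqr_ge0.
have s1 : s < 1.
  rewrite -(@ltr_pXn2r _ 2)// ?nnegrE// expr1n; apply: le_lt_trans h4.
  by rewrite lerDl sqr_ge0.
rewrite -(@ltr_pXn2r _ 2)// ?nnegrE// expr1n real_normK ?num_real//.
apply: le_lt_trans s1; rewrite /s (bigD1 j)//= lerDl.
by apply: sumr_ge0 => k _; exact: sqr_ge0.
Qed.

Lemma measurable_hball : measurable (@hball R n).
Proof.
rewrite (_ : @hball R n = [set: H] `&` hN @^-1` `]-oo, 1[%classic).
  by apply: measurable_hnorm => //; exact: measurable_itv.
by rewrite setTI; apply/seteqP; split => x /=; rewrite in_itv.
Qed.

Lemma measurable_box (A : set (measurableTypeR R)) : measurable A ->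
  measurable [set x : H | forall i, A (tnth x i)].
Proof.
move=> mA; rewrite (_ : mkset _ = \bigcap_(i in [set: 'I_(2 * n).+1])
   ((fun x : H => tnth x i) @^-1` A)).
  apply: fin_bigcap_measurable => // i _.
  by rewrite -[X in measurable X]setTI; exact: measurable_tnth.
by apply/seteqP; split => x /= h i; [move=> _|]; exact: h.
Qed.

Lemma hball_lty : (mu (@hball R n) < +oo)%E.
Proof.
pose A : set (measurableTypeR R) := `](-1), 1[%classic.
have mA : measurable A by exact: measurable_itv.
have A2 : leb A = 2%:E.
  by rewrite lebesgue_measure_itv/= lte_fin -subr_gt0 opprK addr_gt0//.
apply: (@le_lt_trans _ _ (mu [set x : H | forall i, A (tnth x i)])).
  apply: le_measure; rewrite ?inE.
  - exact: measurable_hball.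
  - exact: measurable_box.
  - move=> x /= x1 i; rewrite /A/= in_itv/= -ltr_norml.
    exact: hball_subset_box.
rewrite [X in (X < _)%E](@power_measure_box _ _ R leb _ (fun=> A))//.
by rewrite (eq_bigr (fun=> 2%:E))// prodEFin ltry.
Qed.

Lemma hball_gt0 : (0 < mu (@hball R n))%E.
Proof.
(* The cube of side [c] centred at 0 lies in the ball: each squared coordinate is at most [c / 4],
   so the first [2 n] sum to at most 1/4, and the fourth power of the norm is at most
   [1/16 + 1/4]. *)
pose c : R := (2 * n).+1%:R^-1.
have c0 : 0 < c by rewrite invr_gt0.
have c1 : c <= 1 by rewrite invf_le1// ler1n.
pose A : set (measurableTypeR R) := `](- (c / 2)), (c / 2)[%classic.
have mA : measurable A by exact: measurable_itv.
have Ac : leb A = c%:E.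
  rewrite lebesgue_measure_itv/= lte_fin -subr_gt0 opprK addr_gt0 ?divr_gt0//.
  by congr (_%:E); field.
apply: (@lt_le_trans _ _ (mu [set x : H | forall i, A (tnth x i)])).
  rewrite [X in (_ < X)%E](@power_measure_box _ _ R leb _ (fun=> A))//.
  by rewrite (eq_bigr (fun=> c%:E))// prodEFin lte_fin prodr_gt0.
apply: le_measure; rewrite ?inE.
- exact: measurable_box.
- exact: measurable_hball.
- move=> x hx; rewrite /hball/=.
  rewrite -(@ltr_pXn2r _ 4)// ?nnegrE ?hnorm_ge0// expr1n hnormX4.
  have hx2 i : hcoord x i ^+ 2 <= c / 4.
    have := hx i; rewrite /A/= in_itv/= -ltr_norml => hi.
    rewrite -[leLHS]real_normK ?num_real//.
    apply: (@le_trans _ _ ((c / 2) ^+ 2)).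
      by rewrite ler_pXn2r// ?nnegrE ?ltW// divr_gt0.
    have : 0 <= c * (1 - c) by rewrite mulr_ge0 ?subr_ge0// ltW.
    rewrite expr2; nra.
  set s := \sum_(i < 2 * n) _.
  have s0 : 0 <= s by apply: sumr_ge0 => k _; exact: sqr_ge0.
  have s1 : s <= 4^-1.
    apply: (@le_trans _ _ (\sum_(i < 2 * n) (c / 4))).
      by apply: ler_sum => i _; exact: hx2.
    rewrite sumr_const card_ord -[X in X <= _]mulr_natl mulrA ler_piMl// /c.
    by rewrite ler_pdivrMr// mul1r ler_nat.
  have := hx2 ord_max.
  rewrite (expr2 s); nra.
Qed.

(** At exponent [Q] the function [norm_pow] is the indicator of nonzero norm, hence 1 almost
    everywhere. *)
Lemma ball_pow_heisenberg : ball_pow mu Q hN Q = (Omega_Q R n)%:E.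
Proof.
rewrite /Omega_Q fineK; last by rewrite ge0_fin_numE// hball_lty.
have hH := homogeneous_heisenberg.
have mlt : measurable_fun [set: H] (fun x => (hnorm x < 1)%R%:R : R).
  by apply: measurable_fun_boolr; apply: measurable_fun_ltr => //; exact: measurable_hnorm.
transitivity (\int[mu]_x ((hnorm x < 1)%R%:R * 1)%:E)%E.
  apply: ge0_ae_eq_integral => //.
  - apply/measurable_EFinP; apply: measurable_funM => //.
    exact: (measurable_norm_pow hH).
  - by apply/measurable_EFinP; exact: measurable_funM.
  - by move=> x _; rewrite lee_fin mulr_ge0// norm_pow_ge0.
  have := ae_norm_gt0 hH hnorm_eq0_null; apply: filterS => x Nx _.
  by rewrite /norm_pow Nx subrr powRr0 mulr1.
rewrite -(@integral_setind _ _ _ mu (fun x => hnorm x < 1) (fun=> 1)).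
by rewrite (integral_cst mu measurable_hball 1%:E) mul1e.
Qed.

Lemma Omega_Q_gt0 : 0 < Omega_Q R n.
Proof.
have h := hball_gt0.
by rewrite fine_gt0// h hball_lty.
Qed.

End heisenberg_homogeneous.

(** * The Hardy operator on radial functions of the Heisenberg group *)

Section hardy_heisenberg.
Context (R : realType) (n m : nat).
Local Notation H := (heisenberg R n).
Local Notation mu := (heisenberg_measure R n).
Local Notation pw := (power_measure mu m).
Local Notation Q := ((hdim n)%:R : R).
Local Notation hN := (@hnorm R n).

(** A measurable right inverse of [hnorm] on nonnegative numbers, along the last axis. Composing a
    radial function with it yields a measurable one-variable profile. *)
Definition hpoint (s : R) : H :=
  [tuple (if i == ord_max then s ^+ 2 else 0 : measurableTypeR R) | i < (2 * n).+1].

Lemma hnorm_hpoint (s : R) : 0 <= s -> hnorm (hpoint s) = s.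
Proof.
move=> s0; apply/eqP; rewrite -(@eqrXn2 _ 4) ?hnorm_ge0// hnormX4.
rewrite big1 => [|i _]; last first.
  by rewrite /hcoord tnth_mktuple -val_eqE/= ltn_eqF// expr0n.
by rewrite /hcoord tnth_mktuple eqxx; apply/eqP; ring.
Qed.

Lemma measurable_hpoint : measurable_fun [set: R] hpoint.
Proof.
apply/measurable_fun_tnthP => i.
rewrite (_ : _ \o _ = fun s => if i == ord_max then s ^+ 2 else 0).
  by case: (i == ord_max) => //; exact: exprn_measurable.
by apply/funext => s /=; rewrite tnth_mktuple.
Qed.

Lemma radialE (f : H -> R) : radial f -> f = (fun x => f (hpoint (hnorm x))).
Proof.
by move=> rf; apply/funext => x; apply: rf; rewrite hnorm_hpoint// hnorm_ge0.
Qed.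

Lemma hnorm_tuple_le (y : m.-tuple H) (x : H) :
  (hnorm_tuple y <= hnorm x) = (sqnorm hN y <= hnorm x ^+ 2).
Proof.
rewrite -(@ler_pXn2r _ 2)// ?nnegrE ?hnorm_ge0 ?sqrtr_ge0// sqr_sqrtr//.
by apply: sumr_ge0 => j _; exact: sqr_ge0.
Qed.

Lemma hardyE (f : 'I_m -> H -> R) (x : H) :
  hardy f x = ((hnorm x ^+ (m * hdim n))^-1%:E *
    \int[pw]_y ((sqnorm hN y <= hnorm x ^+ 2)%R%:R *
      \prod_(j < m) f j (tnth y j))%:E)%E.
Proof.
rewrite /hardy integral_setind; congr (_ * _)%E.
by apply: eq_integral => y _; rewrite hnorm_tuple_le.
Qed.

Lemma hnorm_powN (x : H) :
  (hnorm x ^+ (m * hdim n))^-1 = hnorm x `^ (- (m%:R * Q)).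
Proof. by rewrite powRN -natrM powR_mulrn// hnorm_ge0. Qed.

Let measurable_prod_tnth (f : 'I_m -> H -> R) (x : H) :
  (forall j, measurable_fun [set: H] (f j)) ->
  measurable_fun [set: m.-tuple H] (fun y => ((sqnorm hN y <= hnorm x ^+ 2)%R%:R *
      \prod_(j < m) f j (tnth y j))%:E).
Proof.
move=> mf; apply/measurable_EFinP; apply: measurable_funM.
  apply: measurable_fun_boolr; apply: measurable_fun_ler => //.
  exact: (measurable_sqnorm (homogeneous_heisenberg R n)).
by apply: measurable_prod => j _; exact: measurable_fun_tnth_comp.
Qed.

Let measurable_profile (phi : R -> R) : measurable_fun [set: R] phi ->
  measurable_fun [set: H] (fun x => phi (hnorm x)).
Proof. by move=> mphi; exact: (measurableT_comp mphi (@measurable_hnorm R n)). Qed.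

Lemma abse_hardy_le (phi : 'I_m -> R -> R) (x : H) :
  (forall j, measurable_fun [set: R] (phi j)) -> 0 < hnorm x ->
  (`|hardy (fun j (x : H) => phi j (hnorm x)) x| <=
   \int[pw]_y (pos_prod hN phi (hnorm x) y)%:E)%E.
Proof.
move=> mphi Nx; rewrite hardyE hnorm_powN abseM gee0_abs ?lee_fin ?powR_ge0//.
rewrite -(integral_radial_ball (homogeneous_heisenberg R n) (@hnorm_eq0_null R n))//.
apply: lee_wpmul2l; first by rewrite lee_fin powR_ge0.
have mF := @measurable_prod_tnth (fun j (x : H) => phi j (hnorm x)) x
  (fun j => measurable_profile (mphi j)).
apply: le_trans (le_abse_integral _ measurableT mF) _.
rewrite le_eqVlt; apply/orP; left; apply/eqP; apply: eq_integral => y _.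
by rewrite abse_EFin normrM normr_nat normr_prod.
Qed.

Lemma ge0_hardyE (phi : 'I_m -> R -> R) (x : H) :
  (forall j, measurable_fun [set: R] (phi j)) -> (forall j s, 0 <= phi j s) ->
  0 < hnorm x ->
  hardy (fun j (x : H) => phi j (hnorm x)) x =
   (\int[pw]_y (pos_prod hN phi (hnorm x) y)%:E)%E.
Proof.
move=> mphi phi0 Nx; rewrite hardyE hnorm_powN.
rewrite -(integral_radial_ball (homogeneous_heisenberg R n) (@hnorm_eq0_null R n))//.
congr (_ * _)%E; apply: eq_integral => y _; congr ((_ * _)%:E).
by apply: eq_bigr => j _; rewrite ger0_norm.
Qed.

(** For [f] of arbitrary sign and without integrability, the inner integral is the difference of
    those of the positive and negative parts, each measurable by Tonelli. *)
Lemma measurable_hardy (f : 'I_m -> H -> R) :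
  (forall j, measurable_fun [set: H] (f j)) ->
  measurable_fun [set: H] (hardy f).
Proof.
move=> mf.
pose F (p : H * m.-tuple H) := ((sqnorm hN p.2 <= hnorm p.1 ^+ 2)%R%:R *
      \prod_(j < m) f j (tnth p.2 j))%:E.
have mF : measurable_fun [set: H * m.-tuple H] F.
  apply/measurable_EFinP; apply: measurable_funM.
    apply: measurable_fun_boolr; apply: measurable_fun_ler => //.
      exact: (measurableT_comp (measurable_sqnorm (homogeneous_heisenberg R n)) measurable_snd).
    apply: measurable_funX.
    exact: (measurableT_comp (@measurable_hnorm R n) measurable_fst).
  apply: measurable_prod => j _; apply: (measurableT_comp (mf j)).
  exact: (measurableT_comp (measurable_tnth j) measurable_snd).
rewrite (_ : hardy f = fun x => ((hnorm x ^+ (m * hdim n))^-1%:E *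
  (\int[pw]_y F^\+ (x, y) - \int[pw]_y F^\- (x, y)))%E); last first.
  apply/funext => x; rewrite hardyE [in LHS]integralE.
  by congr (_ * (_ - _))%E; apply: eq_integral => y _;
    rewrite ?funeposE ?funenegE.
apply: emeasurable_funM.
  under eq_fun do rewrite hnorm_powN.
  apply/measurable_EFinP.
  exact: (measurableT_comp (measurable_powR _) (@measurable_hnorm R n)).
apply: emeasurable_funB.
  apply: (@measurable_fun_fubini_tonelli_F _ _ H (m.-tuple H) R pw F^\+)%E => //.
  exact: measurable_funepos.
apply: (@measurable_fun_fubini_tonelli_F _ _ H (m.-tuple H) R pw F^\-)%E => //.
exact: measurable_funeneg.
Qed.

(** The two weights differ at most on the null set of norm 0; [norm_pow] is the one with exact
    scaling everywhere. *)
Lemma wLnorm_hweightE (b p : R) (g : H -> \bar R) :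
  measurable_fun [set: H] g ->
  wLnorm (@hweight R n b) p g =
  ((\int[mu]_x (`|g x| `^ p * (norm_pow Q hN (Q + b) x)%:E)) `^ p^-1)%E.
Proof.
move=> mg; rewrite /wLnorm; congr (_ `^ _)%E.
have mgp : measurable_fun [set: H] (fun x => `|g x| `^ p)%E.
  by apply: (measurableT_comp (measurable_poweR _)); exact: measurableT_comp.
apply: ge0_ae_eq_integral => //.
- apply: emeasurable_funM => //; apply/measurable_EFinP.
  exact: (measurableT_comp (measurable_powR _) (@measurable_hnorm R n)).
- apply: emeasurable_funM => //; apply/measurable_EFinP.
  exact: (measurable_norm_pow (homogeneous_heisenberg R n)).
- by move=> x _; rewrite mule_ge0 ?poweR_ge0// lee_fin powR_ge0.
- by move=> x _; rewrite mule_ge0 ?poweR_ge0// lee_fin norm_pow_ge0.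
have := ae_norm_gt0 (homogeneous_heisenberg R n) (@hnorm_eq0_null R n).
apply: filterS => x Nx _.
by rewrite norm_pow_shift Nx mul1r.
Qed.

End hardy_heisenberg.

(** * The operator norm equals the constant *)

Section hardy_opnorm_value.
Context (R : realType) (n m : nat).
Local Notation H := (heisenberg R n).
Local Notation mu := (heisenberg_measure R n).
Local Notation pw := (power_measure mu m).
Local Notation Q := ((hdim n)%:R : R).
Local Notation hN := (@hnorm R n).
Variables (q alpha : R) (qs alphas : 'I_m -> R).
Hypothesis m_gt0 : (0 < m)%N.
Hypothesis q_gt1 : 1 < q.
Hypothesis qs_gt1 : forall j, 1 < qs j.
Hypothesis q_sum : q^-1 = \sum_(j < m) (qs j)^-1.
Hypothesis alpha_sum : alpha = \sum_(j < m) alphas j.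
Local Notation a := (hexp Q q qs alphas).
Hypothesis a_gt0 : forall j, 0 < a j.

Let hH := homogeneous_heisenberg R n.
Let V0 := @Omega_Q_gt0 R n.
Let ballV := @ball_pow_heisenberg R n.
Let q0 : 0 < q. Proof. exact: lt_trans q_gt1. Qed.
Let qs0 j : 0 < qs j. Proof. exact: lt_trans (qs_gt1 j). Qed.
Local Notation K := (hardy_const Q (Omega_Q R n)).

Let wN j (g : H -> R) :=
  wLnorm (hweight (qs j * alphas j / q)) (qs j) (EFin \o g).

Let profile_int (phi : 'I_m -> R -> R) j :=
  (\int[mu]_x (`|phi j (hnorm x)| `^ qs j *
     norm_pow Q hN (Q + qs j * alphas j / q) x)%:E)%E.

Let wN_profile (phi : 'I_m -> R -> R) j : measurable_fun [set: R] (phi j) ->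
  wN j (fun x => phi j (hnorm x)) = (profile_int phi j `^ (qs j)^-1)%E.
Proof.
move=> mphi; rewrite /wN wLnorm_hweightE; last first.
  apply/measurable_EFinP.
  exact: (measurableT_comp mphi (@measurable_hnorm R n)).
by [].
Qed.

Lemma hardy_le_prod (f : 'I_m -> H -> R) :
  (forall j, [/\ measurable_fun [set: H] (f j), radial (f j) &
     (0 < wN j (f j) < +oo)%E]) ->
  (wLnorm (hweight alpha) q (hardy f) / \prod_(j < m) wN j (f j) <= (K a)%:E)%E.
Proof.
move=> hf.
pose phi j (s : R) := f j (hpoint n s).
have mphi j : measurable_fun [set: R] (phi j).
  by have [mf _ _] := hf j; exact: (measurableT_comp mf (@measurable_hpoint R n)).
have fE : f = (fun j (x : H) => phi j (hnorm x)).
  by apply/funext => j; have [_ rf _] := hf j; exact: radialE.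
pose c j := fine (profile_int phi j).
have I0 j : (0 <= profile_int phi j)%E.
  by apply: integral_ge0 => x _; rewrite lee_fin mulr_ge0 ?powR_ge0 ?norm_pow_ge0.
have NE j : wN j (f j) = (profile_int phi j `^ (qs j)^-1)%E.
  by rewrite fE wN_profile.
have Ifin j : (0 < profile_int phi j < +oo)%E.
  have [_ _] := hf j; rewrite NE => /andP[h1 h2]; apply/andP; split.
    by apply: (gt0_poweR _ (I0 j) h1); rewrite invr_gt0.
  by apply: lty_poweRy h2; rewrite invr_eq0 gt_eqF.
have cE j : profile_int phi j = (c j)%:E.
  by rewrite /c fineK// ge0_fin_numE//; case/andP: (Ifin j).
have c0 j : 0 < c j by rewrite -lte_fin -cE; case/andP: (Ifin j).
have -> : (\prod_(j < m) wN j (f j) = (\prod_(j < m) c j `^ (qs j)^-1)%:E)%E.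
  by rewrite -prodEFin; apply: eq_bigr => j _; rewrite NE cE poweR_EFin.
set M := \prod_(j < m) _.
have M0 : 0 < M by apply: prodr_gt0 => j _; exact: powR_gt0.
have K0 : 0 < K a := hardy_const_gt0 hH V0 a_gt0.
rewrite inver gt_eqF// lee_pdivrMr// -EFinM.
have mf j : measurable_fun [set: H] (f j) by have [] := hf j.
rewrite wLnorm_hweightE; last exact: measurable_hardy.
have -> : K a * M = (K a `^ q * \prod_(j < m) c j `^ (q / qs j)) `^ q^-1.
  rewrite powRM ?powR_ge0 ?prodr_ge0//; last by move=> j _; exact: powR_ge0.
  rewrite -powRrM divff ?gt_eqF// powRr1 ?(ltW K0)//; congr (_ * _).
  rewrite powR_prod; last by move=> j; exact: powR_ge0.
  apply: eq_bigr => j _; rewrite -powRrM; congr powR.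
  by field; rewrite !gt_eqF.
rewrite -poweR_EFin; apply: gt0_ler_poweR.
- by rewrite invr_ge0 ltW.
- rewrite in_itv/= leey andbT; apply: integral_ge0 => x _.
  by rewrite mule_ge0 ?poweR_ge0// lee_fin norm_pow_ge0.
- by rewrite in_itv/= leey andbT lee_fin mulr_ge0 ?powR_ge0// prodr_ge0// => j _; exact: powR_ge0.
apply: le_trans (hardy_upper hH V0 ballV m_gt0 q_gt1 qs_gt1 q_sum alpha_sum
  a_gt0 mphi c0 cE).
have mG : measurable_fun [set: H] (fun x => \int[pw]_y (pos_prod hN phi (hnorm x) y)%:E)%E.
  pose g (p : H * m.-tuple H) := (pos_prod hN phi (hnorm p.1) p.2)%:E.
  apply: (@measurable_fun_fubini_tonelli_F _ _ H (m.-tuple H) R pw g).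
    by apply/measurable_EFinP; exact: (measurable_pos_prod hH).
  by move=> p; rewrite lee_fin pos_prod_ge0.
have mW := measurable_norm_pow hH (Q + alpha).
apply: ge0_le_integral => //.
- by move=> x _; rewrite mule_ge0 ?poweR_ge0// lee_fin norm_pow_ge0.
- apply: emeasurable_funM; last exact/measurable_EFinP.
  apply: (measurableT_comp (measurable_poweR _)).
  by apply: measurableT_comp => //; exact: measurable_hardy.
- apply: emeasurable_funM; last exact/measurable_EFinP.
  exact: (measurableT_comp (measurable_poweR _) mG).
move=> x _; have := hnorm_ge0 x; rewrite le_eqVlt => /predU1P[Nx|Nx].
  (* At norm 0, where the value of [hardy] is meaningless, the weight [norm_pow] is 0 and both
     integrands vanish. *)
  by rewrite /norm_pow -Nx ltxx mul0r !mule0.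
apply: lee_wpmul2r; first by rewrite lee_fin norm_pow_ge0.
apply: gt0_ler_poweR.
- exact: ltW.
- by rewrite in_itv/= leey andbT.
- rewrite in_itv/= leey andbT; apply: integral_ge0 => y _.
  by rewrite lee_fin pos_prod_ge0.
by rewrite fE; exact: abse_hardy_le.
Qed.

(** All norms of the profiles are powers of one number [kap], with exponents [1 / qs j] adding up to
    [1 / q]; their product therefore cancels the [1 / q]-th power of the second factor in
    [hardy_lower]. *)
Lemma hardy_extremal_ge eps : 0 < eps ->
  let f j (x : H) := extremal Q q qs alphas eps j (hnorm x) in
  (forall j, [/\ measurable_fun [set: H] (f j), radial (f j) &
     (0 < wN j (f j) < +oo)%E]) /\
  ((K (fun j => a j + eps * (q / qs j)))%:E <=
   wLnorm (hweight alpha) q (hardy f) / \prod_(j < m) wN j (f j))%E.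
Proof.
move=> e0 f; pose phi := extremal Q q qs alphas eps.
have mphi j : measurable_fun [set: R] (phi j) by exact: measurable_extremal.
have phi0 j s : 0 <= phi j s by exact: extremal_ge0.
pose kap := Q * Omega_Q R n / (eps * q).
have kap0 : 0 < kap.
  by rewrite divr_gt0 ?mulr_gt0//; exact: (homog_dim_gt0 hH).
have NE j : wN j (f j) = (kap `^ (qs j)^-1)%:E.
  rewrite [LHS]wN_profile// /profile_int.
  by rewrite (integral_extremal hH ballV)// poweR_EFin.
have mf j : measurable_fun [set: H] (f j).
  exact: (measurableT_comp (mphi j) (@measurable_hnorm R n)).
split.
  move=> j; split; [exact: mf|by move=> x y xy; rewrite /f xy|].
  by rewrite NE lte_fin powR_gt0//= ltry.
have -> : (\prod_(j < m) wN j (f j) = (kap `^ q^-1)%:E)%E.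
  under eq_bigr do rewrite NE.
  rewrite prodEFin q_sum; congr (_%:E).
  elim/big_rec2 : _ => [|j u v _ ->]; first by rewrite powRr0.
  by rewrite -gt0_powRD.
have b0 j : 0 < a j + eps * (q / qs j) by rewrite addr_gt0// mulr_gt0// divr_gt0.
have K0 : 0 < K (fun j => a j + eps * (q / qs j)) := hardy_const_gt0 hH V0 b0.
rewrite inver gt_eqF ?powR_gt0// lee_pdivlMr ?powR_gt0// -EFinM.
rewrite wLnorm_hweightE; last exact: measurable_hardy.
set Ke := K _.
have -> : Ke * kap `^ q^-1 = (Ke `^ q * kap) `^ q^-1.
  by rewrite powRM ?powR_ge0 ?(ltW kap0)// -powRrM divff ?gt_eqF// powRr1// ltW.
rewrite -poweR_EFin; apply: gt0_ler_poweR.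
- by rewrite invr_ge0 ltW.
- by rewrite in_itv/= leey andbT lee_fin mulr_ge0 ?powR_ge0// ltW.
- rewrite in_itv/= leey andbT; apply: integral_ge0 => x _.
  by rewrite mule_ge0 ?poweR_ge0// lee_fin norm_pow_ge0.
apply: le_trans (hardy_lower hH V0 ballV q_gt1 qs_gt1 q_sum alpha_sum a_gt0 e0) _.
rewrite le_eqVlt; apply/orP; left; apply/eqP; apply: eq_integral => x _.
have := hnorm_ge0 x; rewrite le_eqVlt => /predU1P[Nx|Nx].
  by rewrite /norm_pow -Nx ltxx mul0r !mule0.
rewrite (ge0_hardyE mphi phi0 Nx) gee0_abs//.
by apply: integral_ge0 => y _; rewrite lee_fin pos_prod_ge0.
Qed.

Lemma hardy_opnormE : hardy_opnorm n q alpha qs alphas = (K a)%:E.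
Proof.
apply/eqP; rewrite eq_le; apply/andP; split.
  apply: ge_ereal_sup => _ [f hf <-]; exact: hardy_le_prod.
apply: (hardy_const_cvg hH ballV q_gt1 qs_gt1 a_gt0) => eps e0.
have [hf hle] := hardy_extremal_ge e0.
by apply: (le_trans hle); apply: ereal_sup_ubound; eexists; [exact: hf|].
Qed.

End hardy_opnorm_value.

(** The relation [Gamma (s + 1) = s * Gamma s] cancels each [a j] and leaves 1/2 per factor, while
    the denominator contributes 2 over the sum of the [a j]: this is where the power [1 - m] of 2
    comes from. *)
Lemma hardy_constE (R : realType) (Q V : R) m (a : 'I_m -> R) : (0 < m)%N ->
  (forall j, 0 < a j) ->
  hardy_const Q V a =
  (Q * V) ^+ m * 2 ^ (1 - m%:Z) / (\sum_(j < m) a j) *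
  ((\prod_(j < m) Gamma (a j / 2)) / Gamma ((\sum_(j < m) a j) / 2)).
Proof.
move=> m0 a0; set A := \sum_(j < m) a j.
have A0 : 0 < A.
  rewrite /A (bigD1 (Ordinal m0))//= ltr_pwDl// sumr_ge0// => j _; exact: ltW.
rewrite /hardy_const -/A GammaS ?divr_gt0//.
have -> : \prod_(j < m) (Q * V / a j * Gamma (a j / 2 + 1)) =
    (Q * V / 2) ^+ m * \prod_(j < m) Gamma (a j / 2).
  rewrite -[m in _ ^+ m]card_ord -prodr_const -big_split/=.
  apply: eq_bigr => j _; rewrite GammaS ?divr_gt0//.
  by field; rewrite gt_eqF.
have -> : (2 : R) ^ (1 - m%:Z) = 2 / 2 ^+ m.
  by rewrite expfzDr ?pnatr_eq0// expr1z -exprnN.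
rewrite expr_div_n; field.
by rewrite expf_neq0 ?pnatr_eq0// !gt_eqF ?Gamma_gt0 ?divr_gt0.
Qed.

Theorem corollary4p1 (R : realType) (n m : nat) (q alpha : R)
    (qs alphas : 'I_m -> R)
    (n_ge1 : (1 <= n)%N) (m_ge1 : (1 <= m)%N)
    (q_gt1 : 1 < q) (qs_gt1 : forall j, 1 < qs j)
    (q_sum : q^-1 = \sum_(j < m) (qs j)^-1)
    (alpha_sum : alpha = \sum_(j < m) alphas j)
    (alphas_cond : forall j,
      0 < - (alphas j / q) - (hdim n)%:R / qs j + (hdim n)%:R) :
  hardy_opnorm n q alpha qs alphas =
  (q * omega_Q R n ^+ m * 2 ^ (1 - m%:Z)
     / (m%:R * q * (hdim n)%:R - alpha - (hdim n)%:R)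
   * ((\prod_(j < m)
         Gamma (((hdim n)%:R - alphas j / q - (hdim n)%:R / qs j) / 2))
      / Gamma ((m%:R * (hdim n)%:R - alpha / q - (hdim n)%:R / q) / 2)))%:E.
Proof.
have m0 : (0 < m)%N by [].
have q0 : 0 < q by rewrite (lt_trans ltr01).
have qs0 j : 0 < qs j by rewrite (lt_trans ltr01).
pose Q : R := (hdim n)%:R.
have a0 j : 0 < hexp Q q qs alphas j.
  by have := alphas_cond j; rewrite /hexp -/Q; congr (0 < _); ring.
have sumA : \sum_(j < m) hexp Q q qs alphas j = m%:R * Q - alpha / q - Q / q.
  rewrite /hexp sumrB sumr_const card_ord mulr_natl.
  rewrite big_split/= -mulr_sumr -mulr_suml -q_sum -alpha_sum; ring.
rewrite (hardy_opnormE m0 q_gt1 qs_gt1 q_sum alpha_sum a0).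
congr (_%:E); rewrite hardy_constE// sumA -/(omega_Q R n).
have A0 : 0 < m%:R * Q - alpha / q - Q / q.
  rewrite -sumA (bigD1 (Ordinal m0))//= ltr_pwDl// sumr_ge0// => j _; exact: ltW.
congr (_ * (_ / _)).
  rewrite -/Q /omega_Q.
  (* The denominator of the claim is [q] times the sum of the [hexp j], which absorbs the [q] in the
     numerator. *)
  have -> : m%:R * q * Q - alpha - Q = q * (m%:R * Q - alpha / q - Q / q).
    by field; rewrite gt_eqF.
  move: (m%:R * Q - alpha / q - Q / q) A0 => A A0.
  by field; rewrite !gt_eqF.
by apply: eq_bigr => j _; rewrite /hexp; congr (Gamma (_ / 2)); ring.
Qed.
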